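(* Let $G=G([n],E)$ be a connected comparability graph with Laplacian matrix $L=L(G)$ and canonical partition $\mathcal{P}=\mathcal{P}(G)$. Let $\lambda_{\max}$ be the largest eigenvalue of $L$ and $\mathcal{E}_{\max}=\{x\in\mathbb{R}^{[n]}:Lx=\lambda_{\max}x\}$ its eigenspace. Then: \begin{itemize} \item[i.] If $O$ is a transitive orientation of $G$, then $\dim\langle C_O\cap\mathcal{E}_{\max}\rangle=\dim\langle\mathcal{E}_{\max}\rangle$. \item[ii.] $\mathcal{E}_{\max}\subseteq\bigcup_O C_O$, where the union is over all transitive orientations $O$ of $G$. \item[iii.] Let $x\in\mathcal{E}_{\max}$ be a u.c.u.v. Almost surely: \begin{itemize} \item[1.] If $A\in\mathcal{P}$, then $A$ is contained in a fiber of $x$. \item[2.] If $A,A'\in\mathcal{P}$ are completely adjacent in $G$, then $A$ and $A'$ are contained in different fibers of $x$. \item[3.] $x$ induces a transitive orientation of $G^{\mathcal{P}}$ (i.e. the orientation $O_x(G^{\mathcal{P}})$ of the edges of $G^{\mathcal{P}}$ is a transitive orientation of $G^{\mathcal{P}}$). In particular, $G^{\mathcal{P}}$ is a comparability graph. \item[4.] Every transitive orientation of $G^{\mathcal{P}}$ is induced by $x$ (as in 3.) with positive probability. \item[5.] If $\xi$ is a fiber of $x$, then $G[\xi]=G[B_1]+\dots+G[B_k]$ (disjoint union), where for all $i\in[k]$, $B_i$ is a connected module of $G$ and $G[B_i]$ is a comparability graph. \item[6.] $G$ has exactly two transitive orientations if and only if $\dim\langle\mathcal{E}_{\max}\rangle=1$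 and every fiber of $x$ is an independent set of $G$. \end{itemize} \item[iv.] If $\overline{G}$ is connected, then $\dim\langle\mathcal{E}_{\max}\rangle=1$. If $\overline{G}$ is disconnected, then $\dim\langle\mathcal{E}_{\max}\rangle$ equals the number of connected components of $\overline{G}$ minus one. \end{itemize}
   Context: Graphs are simple undirected on vertex set $[n]=\{1,\dots,n\}$. The Laplacian $L$ has $L_{ii}=\deg i$, $L_{ij}=-1$ if $\{i,j\}\in E$, $0$ otherwise. $\overline{G}$ is the complement graph, $G[X]$ the induced subgraph, $+$ disjoint union. $N(X)=\{j\in[n]\setminus X:\exists i\in X,\{i,j\}\in E\}$. Sets $X,Y$ are completely adjacent if $X\cap Y=\emptyset$ and $\{i,j\}\in E$ for all $i\in X,j\in Y$. A module of $G$ is $A\subseteq[n]$ with $N(i)\setminus A=N(j)\setminus A=N(A)$ for all $i,j\in A$; it is proper if $A\neq[n]$, non-trivial if $|A|>1$, connected if $G[A]$ is connected. For connected $G$, the canonical partition $\mathcal{P}(G)$ is: if $\overline{G}$ is connected, the unique partition of $[n]$ into the maximal (by inclusion) proper modules of $G$; if $\overline{G}$ is disconnected, the partition of $[n]$ into vertex sets of connected components of $\overline{G}$. The copartition subgraph $G^{\mathcal{P}}$ has vertex set $[n]$ and edge set $E$ minus all edges with both endpoints in the same block of $\mathcal{P}$. An acyclic orientation $O$ orients every edge with no directed cycles; it is transitive if $G$ equals the comparability graph of the partial order ''$u<v$ iff there is a directed path from $u$ to $v$ in $O$'' (equivalently, for comparability graphs, $G$ is a comparability graph iff it has a transitive orientation).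 For an acyclic orientation $O$, $C_O=\{x\in\mathbb{R}^{[n]}:x_i\le x_j\text{ for all }(i,j)\in O\}$ (the closure of the corresponding region of the graphical arrangement). For $x\in\mathbb{R}^{[n]}$, the induced orientation $O_x$ of a graph $H$ on $[n]$ sends edge $\{i,j\}$ to $\{i,j\}$ (unoriented) if $x_i=x_j$, to $(i,j)$ if $x_i<x_j$, to $(j,i)$ if $x_i>x_j$. A set $\xi\subseteq[n]$ is a fiber of $x$ if there is $\alpha\in\mathbb{R}$ with $x_i=\alpha\iff i\in\xi$. $\dim\langle S\rangle$ is the dimension of the linear span of $S$. For a subspace $\mathcal{V}$ of positive dimension, a u.c.u.v. $x\in\mathcal{V}$ is chosen uniformly at random from the unit sphere of $\mathcal{V}$; ''almost surely'' means with probability one.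
   Formalization: Part iii.6 is stated only for graphs with at least two vertices: the one-vertex graph has exactly one transitive orientation although its top eigenspace has dimension 1 and all fibers are independent, so the equivalence fails there. *)

(* Defs.v *)
From HB Require Import structures.
From mathcomp Require Import all_boot all_order all_algebra.
From mathcomp Require Import all_classical all_reals all_analysis.
Set Implicit Arguments.
Unset Strict Implicit.
Unset Printing Implicit Defensive.
Import Order.TTheory GRing.Theory Num.Theory.
Import numFieldNormedType.Exports.

Record sgraph (V : finType) := SGraph {
  adj :> rel V;
  adj_sym : symmetric adj;
  adj_irr : irreflexive adj
}.

Section Graphs.
Variable V : finType.
Implicit Types (G : sgraph V) (A B X Y : {set V}) (P : {set {set V}})
  (O : {set V * V}).
Local Open Scope set_scope.

Fact compl_sym G : symmetric [rel u v | (u != v) && ~~ G u v].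
Proof. by move=> u v; rewrite /= eq_sym adj_sym. Qed.
Fact compl_irr G : irreflexive [rel u v | (u != v) && ~~ G u v].
Proof. by move=> u; rewrite /= eqxx. Qed.
Definition complement_graph G := SGraph (compl_sym G) (compl_irr G).

Fact induced_sym G A :
  symmetric [rel u v : {x : V | x \in A} | G (val u) (val v)].
Proof. by move=> u v; rewrite /= adj_sym. Qed.
Fact induced_irr G A :
  irreflexive [rel u v : {x : V | x \in A} | G (val u) (val v)].
Proof. by move=> u; rewrite /= adj_irr. Qed.
Definition induced_subgraph G A :=
  SGraph (@induced_sym G A) (@induced_irr G A).

(* The graph without vertices is not connected. *)
Definition graph_connected G : bool :=
  (0 < #|V|)%N && [forall u, forall v, connect G u v].

Definition graph_components G : {set {set V}} :=
  [set [set v | connect G u v] | u : V].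

Definition nbhd G X : {set V} :=
  [set j | (j \notin X) && [exists i in X, G i j]].

Definition completely_adjacent G X Y : bool :=
  [disjoint X & Y] && [forall i in X, forall j in Y, G i j].

Definition independent G X : bool :=
  [forall i in X, forall j in X, ~~ G i j].

Definition is_module G A : bool :=
  [forall i in A, forall j in A,
     (nbhd G [set i] :\: A == nbhd G [set j] :\: A)
     && (nbhd G [set j] :\: A == nbhd G A)].

Definition proper_module G A : bool := is_module G A && (A != [set: V]).

(* For connected G with at least two vertices, this is the canonical
   partition. On a one-vertex graph the only proper module is set0, so no
   partition into maximal proper modules exists there. *)
Definition canonical_partition G : {set {set V}} :=
  if graph_connected (complement_graph G) then [set A | maxset (proper_module G) A]
  else graph_components (complement_graph G).

Definition same_block P : rel V :=
  [rel u v | [exists A in P, (u \in A) && (v \in A)]].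

Fact copartition_sym G P : symmetric [rel u v | G u v && ~~ same_block P u v].
Proof.
move=> u v; rewrite /= adj_sym; congr (_ && ~~ _).
by apply: eq_existsb => A; congr (_ && _); rewrite andbC.
Qed.
Fact copartition_irr G P :
  irreflexive [rel u v | G u v && ~~ same_block P u v].
Proof. by move=> u; rewrite /= adj_irr. Qed.
Definition copartition G P := SGraph (copartition_sym G P) (copartition_irr G P).

(* An orientation is given by its set of arcs. *)
Definition arc_rel O : rel V := [rel u v | (u, v) \in O].

Definition is_orientation G O : bool :=
  [forall u, forall v,
     (arc_rel O u v ==> G u v) && (G u v ==> (arc_rel O u v (+) arc_rel O v u))].

(* There is a directed path of length at least one from u to v. *)
Definition dipath O : rel V :=
  [rel u v | [exists w, arc_rel O u w && connect (arc_rel O) w v]].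

Definition acyclic_orientation G O : bool :=
  is_orientation G O && [forall u, ~~ dipath O u u].

Definition transitive_orientation G O : bool :=
  acyclic_orientation G O
  && [forall u, forall v, G u v == (dipath O u v || dipath O v u)].

Definition transitive_orientations G : {set {set V * V}} :=
  [set O | transitive_orientation G O].

End Graphs.

Definition comparability_graph (V : finType) (G : sgraph V) : Prop :=
  exists lt : rel V,
    [/\ irreflexive lt, transitive lt & forall u v, G u v = lt u v || lt v u].

(* G[xi] is the disjoint union of the graphs G[B], for B in the family Q,
   and each B is nonempty. *)
Definition induced_disjoint_union (V : finType) (G : sgraph V)
    (xi : {set V}) (Q : {set {set V}}) : Prop :=
  finset.partition Q xi /\
  (forall A B, A \in Q -> B \in Q -> A != B ->
     forall u v, u \in A -> v \in B -> ~~ G u v).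

Local Open Scope classical_set_scope.
Local Open Scope ring_scope.

Definition lin_span (K : fieldType) (V : vectType K) (S : set V) : {vspace V} :=
  xget fullv [set W : {vspace V} |
    (forall v, S v -> v \in W) /\
    (forall W' : {vspace V}, (forall v, S v -> v \in W') -> (W <= W')%VS)].

Lemma lin_spanP (K : fieldType) (V : vectType K) (S : set V) :
  (forall v, S v -> v \in lin_span S) /\
  (forall W' : {vspace V},
     (forall v, S v -> v \in W') -> (lin_span S <= W')%VS).
Proof.
rewrite /lin_span; case: xgetP => [W _ [] //|noW]; exfalso.
pose p d := `[< exists2 W : {vspace V}, (forall v, S v -> v \in W) &
                 \dim W = d >].
have exp : exists d, p d.
  by exists (\dim {: V}); apply/asboolP; exists fullv => // v _; rewrite memvf.
case: (ex_minnP exp) => d /asboolP[W SW dW] dmin.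
apply: (noW W); split=> // W' SW'.
have SI v : S v -> v \in (W :&: W')%VS.
  by move=> Sv; rewrite memv_cap SW ?SW'.
have /dmin : p (\dim (W :&: W')%VS) by apply/asboolP; exists (W :&: W')%VS.
rewrite -dW => leW.
have /eqP <- : (W :&: W')%VS == W by rewrite eqEdim capvSl leW.
exact: capvSr.
Qed.

Definition dim_linspan (K : fieldType) (V : vectType K) (S : set V) : nat :=
  \dim (lin_span S).

Section Vectors.
Variables (R : realType) (n : nat).
Implicit Types (G : sgraph 'I_n) (x : 'cV[R]_n) (O : {set 'I_n * 'I_n}).

Definition laplacian G : 'M[R]_n :=
  \matrix_(i, j) (if i == j then #|[set k | G i k]%SET|%:R
                  else if G i j then -1 else 0).

Definition largest_eigenvalue (M : 'M[R]_n) (lam : R) : Prop :=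
  eigenvalue M lam /\ forall a, eigenvalue M a -> a <= lam.

(* The library eigenspace acts on row vectors. *)
Definition col_eigenspace (M : 'M[R]_n) (lam : R) : set 'cV[R]_n :=
  [set x | M *m x = lam *: x].

Definition cone O : set 'cV[R]_n :=
  [set x | forall i j, (i, j) \in O -> x i 0 <= x j 0].

(* The arcs of O_x; the edges left unoriented by x contribute no arc, so
   is_orientation H (induced_orientation H x) says that all edges of H get
   oriented. *)
Definition induced_orientation (H : sgraph 'I_n) x : {set 'I_n * 'I_n} :=
  [set p | H p.1 p.2 && (x p.1 0 < x p.2 0)]%SET.

Definition fiber x (xi : {set 'I_n}) : Prop :=
  exists alpha : R, forall i, x i 0 = alpha <-> i \in xi.

(* R^n with its Borel sigma-algebra. *)
Definition borel_cV := g_sigma_algebraType (@open 'cV[R]_n).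

(* The Euclidean unit sphere of U; the library norm on matrices is the
   sup norm. *)
Definition unit_sphere (U : set 'cV[R]_n) : set 'cV[R]_n :=
  [set x | U x /\ \sum_i x i 0 ^+ 2 = 1].

(* The uniform distribution on the unit sphere of a subspace U of positive
   dimension is the unique Borel probability measure carried by that sphere
   and invariant under all linear isometries of U. Every isometry of U
   extends to an orthogonal matrix of R^n that preserves U. *)
Definition uniform_on_sphere (U : set 'cV[R]_n) (mu : probability borel_cV R) :
    Prop :=
  mu (unit_sphere U) = 1%E /\
  forall Q : 'M[R]_n, Q^T *m Q = 1%:M ->
    (forall v : 'cV[R]_n, U v -> U (Q *m v)) ->
    forall B : set borel_cV, measurable B ->
      mu ((fun v : 'cV[R]_n => Q *m v) @^-1` B) = mu B.

End Vectors.

(* Main.v *)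
Require Import Defs.
From mathcomp Require Import all_boot all_order all_algebra.
From mathcomp Require Import all_classical all_reals all_analysis.
From mathcomp Require Import ring lra zify complex.
Set Implicit Arguments.
Unset Strict Implicit.
Unset Printing Implicit Defensive.
Import Order.TTheory GRing.Theory Num.Theory.
Import numFieldNormedType.Exports.

(* The Laplacian maps the cone of a transitive orientation to itself, so the
   orthogonal projection on the top eigenspace, a limit of normalized powers of
   the Laplacian, does too; since the cone has nonempty interior, its top
   eigenvectors span the eigenspace. The same termwise estimate shows that
   vertices separating two adjacent vertices of equal value share that value,
   so the components of the fibers of a top eigenvector are modules.
   If the complement of G is disconnected, the top eigenvalue is n and its
   eigenvectors are the zero-sum functions constant on the co-components.
   Otherwise, for each proper module A, the top eigenvalue exceeds
   |A| + |N(A)|, which forces eigenvectors to be constant on A; an eigenvector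
   in a cone then separates all pairs of adjacent blocks, and subtracting
   multiples until separation fails shows that the eigenspace is a line.
   The uniform measure enters in two ways: by invariance under reflections,
   proper subspaces are null, since infinitely many of their images have null
   pairwise intersections, and open sets meeting the sphere are not null, since
   countably many images of a small ball cover the sphere. *)

(** * Transitive orientations, modules and the canonical partition *)

(** Powers of the Laplacian, rather than of some shifted matrix, may be used because it is positive
    semidefinite: its top eigenvalue is then also the largest in absolute value, and normalized
    powers converge. That the cones cover the top eigenspace has a different reason in each case. If
    the complement is disconnected, distinct co-components are completely joined, and any weak order
    of them that follows the values of an eigenvector can be refined to a transitive orientation. If
    the complement is connected, the eigenspace is a line; a half of it lies in the cone of any
    given transitive orientation, the other half in the cone of the reverse. Probability is kept
    apart from this. Every top eigenvector is constant on blocks, and the only further demand is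
    that it differ across each edge between blocks. All almost sure claims are proved for every such
    vector, and only then is the exceptional set shown to be null. *)

Section Orientations.
Variables (V : finType) (G : sgraph V).
Implicit Types O : {set V * V}.
Local Open Scope set_scope.

Lemma connect_transitive (e : rel V) x y :
  transitive e -> connect e x y -> x = y \/ e x y.
Proof.
move=> te /connectP[p]; elim: p x => [|z p IHp] x /=; first by left.
move=> /andP[xz pz] yE; right; have [<-//|zy] := IHp _ pz yE.
exact: te zy.
Qed.

(** Two consecutive arcs form a directed path, so their ends are adjacent, and acyclicity fixes the
    direction of that edge. Directed paths thus collapse to arcs, and all later arguments use this
    local form. *)
Lemma transitive_orientationP O :
  reflect [/\ forall u v, (u, v) \in O -> G u v,
              forall u v, G u v -> ((u, v) \in O) (+) ((v, u) \in O)
            & transitive (arc_rel O)]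
          (transitive_orientation G O).
Proof.
apply: (iffP idP) => [/andP[/andP[/'forall_forallP oP /forallP acyc]
  /'forall_forallP trP]|].
  have OG u v : (u, v) \in O -> G u v.
    by move=> uv; have /andP[/implyP h _] := oP u v; apply: h.
  have GO u v : G u v -> ((u, v) \in O) (+) ((v, u) \in O).
    by move=> uv; have /andP[_ /implyP] := oP u v; apply.
  split=> // v u w uv vw.
  have duw : dipath O u w by apply/existsP; exists v; rewrite uv connect1.
  have Guw : G u w by rewrite (eqP (trP u w)) duw.
  have := GO _ _ Guw; rewrite /arc_rel/=; case: ((u, w) \in O) => //= wu.
  have /negP[] := acyc u; apply/existsP; exists v.
  by rewrite uv; apply: connect_trans (connect1 vw) (connect1 _).
move=> [OG GO tr].
have dpE u v : dipath O u v = ((u, v) \in O).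
  apply/existsP/idP => [[w /andP[uw /(connect_transitive tr)[<-//|]]]|uv].
    exact: tr.
  by exists v; rewrite [arc_rel O u v]uv connect0.
apply/andP; split; first (apply/andP; split).
- apply/'forall_forallP => u v; apply/andP; split; apply/implyP;
    first exact: OG.
  exact: GO.
- by apply/forallP => u; rewrite dpE; apply/negP => /OG; rewrite adj_irr.
- apply/'forall_forallP => u v; rewrite !dpE; apply/eqP;
    apply/idP/idP => [/GO|/orP].
    by case: (_ \in O).
  by move=> [/OG//|/OG]; rewrite adj_sym.
Qed.

Lemma transitive_orientation_rel (lt : rel V) :
  irreflexive lt -> transitive lt -> (forall u v, G u v = lt u v || lt v u) ->
  transitive_orientation G [set p | lt p.1 p.2].
Proof.
move=> irr tr GE; apply/transitive_orientationP; split=> [u v|u v|v u w].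
- by rewrite inE GE /= => ->.
- rewrite !inE GE /=; case uv : (lt u v); case vu : (lt v u) => //.
  by have := tr _ _ _ uv vu; rewrite irr.
- by rewrite /arc_rel/= !inE; apply: tr.
Qed.

Definition reverse_orientation O : {set V * V} := [set p | (p.2, p.1) \in O].

Lemma reverse_transitive_orientation O :
  transitive_orientation G O -> transitive_orientation G (reverse_orientation
    O).
Proof.
move=> /transitive_orientationP[OG GO tr]; apply/transitive_orientationP.
split=> [u v|u v|v u w]; rewrite ?inE /=.
- by move=> /OG; rewrite adj_sym.
- by rewrite addbC; apply: GO.
- by rewrite /arc_rel/= !inE/= => vu wv; apply: tr wv vu.
Qed.

Lemma comparability_graph_orientable :
  comparability_graph G -> exists O, transitive_orientation G O.
Proof.
move=> [lt [irr tr GE]]; exists [set p | lt p.1 p.2].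
exact: transitive_orientation_rel.
Qed.

Lemma orientable_comparability_graph O :
  transitive_orientation G O -> comparability_graph G.
Proof.
move=> /transitive_orientationP[OG GO tr]; exists (arc_rel O); split=> //.
- by move=> u; apply/negP => /OG; rewrite adj_irr.
- move=> u v; apply/idP/orP => [/GO|].
    by rewrite /arc_rel/=; case: (_ \in O) => //= uv; [left|right].
  by move=> [/OG//|/OG]; rewrite adj_sym.
Qed.

Lemma reverse_orientation_neq O u v : transitive_orientation G O -> G u v ->
  reverse_orientation O <> O.
Proof.
move=> /transitive_orientationP[_ GO _] /GO uv OE.
by move: uv; rewrite -{1}OE inE addbb.
Qed.

Lemma two_transitive_orientations O u v : G u v ->
  transitive_orientation G O ->
  (forall O', transitive_orientation G O' -> O' = O \/ O' =
    reverse_orientation O) ->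
  #|transitive_orientations G| = 2%N.
Proof.
move=> Guv tO unique.
have -> : transitive_orientations G = [set O; reverse_orientation O].
  apply/setP => O'; rewrite !inE; apply/idP/orP => [/unique[]->|[]/eqP->//].
  - by left.
  - by right.
  - exact: reverse_transitive_orientation.
by rewrite cards2 eq_sym (introN eqP (reverse_orientation_neq tO Guv)).
Qed.

Lemma two_transitive_orientations_reverse O O' u v :
  G u v -> #|transitive_orientations G| = 2%N ->
  transitive_orientation G O -> transitive_orientation G O' ->
  O' = O \/ O' = reverse_orientation O.
Proof.
move=> Guv card2 tO tO'.
have [->|O'O] := eqVneq O' O; first by left.
have [->|O'rO] := eqVneq O' (reverse_orientation O); first by right.
have : O' |: [set O; reverse_orientation O] \subset transitive_orientations G.
  apply/fintype.subsetP => W; rewrite !inE => /or3P[]/eqP->//.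
  exact: reverse_transitive_orientation.
move=> /subset_leq_card; rewrite card2 cardsU1 cards2 !inE (negPf O'O) (negPf
  O'rO).
by rewrite eq_sym (introN eqP (reverse_orientation_neq tO Guv)).
Qed.

End Orientations.

Section Modules.
Variables (V : finType) (G : sgraph V).
Implicit Types A B X : {set V}.
Local Open Scope set_scope.

Lemma is_moduleP A :
  reflect (forall i j k, i \in A -> j \in A -> k \notin A -> G i k = G j k)
          (is_module G A).
Proof.
have in1 i k : i \in A -> (k \in nbhd G [set i] :\: A) = (k \notin A) && G i k.
  move=> iA; rewrite !inE; case kA : (k \in A) => //=.
  have -> : k != i by apply: contraFneq kA => ->.
  apply/existsP/idP => [[i']|ik]; first by rewrite inE => /andP[/eqP->].
  by exists i; rewrite inE eqxx.
apply: (iffP idP) => [/'forall_in_'forall_in_andP mA i j k iA jA kA|mA].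
  have [/eqP/setP/(_ k) + _] := mA i iA j jA.
  by rewrite !in1// kA.
apply/'forall_in_'forall_in_andP => i iA j jA; split; apply/eqP/setP => k.
  by rewrite !in1//; case kA : (k \in A) => //=; apply: mA; rewrite ?kA.
rewrite in1// [in RHS]inE; case kA : (k \in A) => //=.
apply/idP/existsP => [jk|[i' /andP[i'A]]]; first by exists j; rewrite jA.
by rewrite (mA i' j k) ?kA.
Qed.

Lemma connected_cut X u v : graph_connected G -> u \in X -> v \notin X ->
  exists a b, [/\ a \in X, b \notin X & G a b].
Proof.
move=> /andP[_ /'forall_forallP conn] uX vX.
have [/existsP[a /existsP[b /and3P[]]]|no] :=
  boolP [exists a, exists b, [&& a \in X, b \notin X & G a b]].
  by exists a, b.
have closedX : fingraph.closed G (mem X).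
  apply: intro_closed; first exact: sym_connect_sym (@adj_sym _ G).
  move=> a b ab aX; apply: contraNT no => bX.
  by apply/existsP; exists a; apply/existsP; exists b; rewrite aX bX.
by have := closed_connect closedX (conn u v); rewrite uX (negPf vX).
Qed.

End Modules.

Section ModuleComponents.
Variables (V : finType) (G : sgraph V).
Implicit Types A B X : {set V}.
Local Open Scope set_scope.

Lemma connect_induced (B : {set V}) (u v : {x : V | x \in B}) :
  connect [rel a b | [&& a \in B, b \in B & G a b]] (val u) (val v) ->
  connect (induced_subgraph G B) u v.
Proof.
move=> /connectP[p]; elim: p u => [|z p IHp] u /=.
  by move=> _ /val_inj ->; exact: connect0.
move=> /andP[/and3P[_ zB uz] pz] vE.
by apply: connect_trans (connect1 _) (IHp (Sub z zB) pz vE).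
Qed.

Lemma induced_comparability_graph B :
  comparability_graph G -> comparability_graph (induced_subgraph G B).
Proof.
move=> [lt [irr tr GE]]; exists (fun u v => lt (val u) (val v)); split.
- by move=> u; exact: irr.
- by move=> v u w; exact: tr.
- by move=> u v; exact: GE.
Qed.

(** The parts are the components of [G] on [X]. An outside vertex adjacent to just one end of an
    edge of a component would belong to [X] by hypothesis, hence to the component; so adjacency to
    an outside vertex is constant along paths. *)
Lemma module_components X :
  (forall i j k, i \in X -> j \in X -> G i j -> G i k -> ~~ G j k -> k \in X) ->
  exists Q : {set {set V}}, induced_disjoint_union G X Q /\
    forall B, B \in Q -> is_module G B /\ graph_connected (induced_subgraph G
      B).
Proof.
move=> closedX; pose e := [rel a b | [&& a \in X, b \in X & G a b]].
have e_sym : symmetric e by move=> a b /=; rewrite adj_sym andbCA.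
have ce_sym : connect_sym e by exact: sym_connect_sym.
have eqv : {in X & &, equivalence_rel (connect e)}.
  move=> a b c _ _ _; split=> [|ab]; first exact: connect0.
  by apply/idP/idP; apply: connect_trans; rewrite // ce_sym.
pose Q := equivalence_partition (connect e) X.
have partQ : finset.partition Q X := equivalence_partitionP eqv.
have inQ B a b : B \in Q -> a \in B -> (b \in B) = (b \in X) && connect e a b.
  move=> /imsetP[c cX ->]; rewrite !inE => /andP[aX ca].
  by congr (_ && _); apply/idP/idP; apply: connect_trans; rewrite // ce_sym.
have QX B a : B \in Q -> a \in B -> a \in X.
  by move=> BQ aB; have := inQ _ _ a BQ aB; rewrite aB => /esym/andP[].
exists Q; split.
  split=> // A B AQ BQ /eqP AB a b aA bB; apply: contra_notN AB => ab.
  have aX := QX _ _ AQ aA; have bX := QX _ _ BQ bB.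
  apply/setP => c; rewrite (inQ _ _ _ AQ aA) (inQ _ _ _ BQ bB).
  have eab : e a b by rewrite /= aX bX.
  congr (_ && _); apply/idP/idP; apply: connect_trans; last exact: connect1.
  by rewrite ce_sym; exact: connect1.
move=> B BQ; split.
  apply/is_moduleP => i j k iB jB kB.
  have step a b : connect e i a -> e a b -> G a k = G b k.
    move=> ia /and3P[aX bX ab].
    have aB : a \in B by rewrite (inQ _ _ _ BQ iB) aX.
    have bB : b \in B by rewrite (inQ _ _ _ BQ aB) bX connect1//= aX bX.
    have cont a' b' : a' \in B -> b' \in B -> G a' b' -> G a' k -> G b' k.
      move=> a'B b'B a'b' a'k; apply: contraNT kB => b'k.
      have a'X := QX _ _ BQ a'B; have b'X := QX _ _ BQ b'B.
      have kX := closedX _ _ _ a'X b'X a'b' a'k b'k.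
      by rewrite (inQ _ _ _ BQ a'B) kX connect1//= a'X kX.
    by apply/idP/idP; apply: cont => //; rewrite adj_sym.
  have gen p a : connect e i a -> path e a p -> G a k = G (last a p) k.
    elim: p a => [|b p IHp] a //= ia /andP[ab pb].
    rewrite (step _ _ ia ab); apply: IHp pb.
    by apply: (connect_trans ia); exact: connect1.
  move: jB; rewrite (inQ _ _ _ BQ iB) => /andP[_ /connectP[p pp ->]].
  exact: gen (connect0 _ _) pp.
apply/andP; split.
  have /and3P[_ _ Q0] := partQ.
  have [x xB|B0] := pickP (mem B).
    by apply/card_gt0P; exists (Sub x xB).
  by case/negP: Q0; rewrite (_ : finset.set0 = B)//; apply/setP => x;
    rewrite inE; apply: esym (B0 x).
apply/'forall_forallP => -[u uB] [v vB]; apply: connect_induced => /=.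
have : connect e u v by move: vB; rewrite (inQ _ _ _ BQ uB) => /andP[].
move=> /connectP[p + vE]; rewrite vE {v vB vE}.
elim: p u uB => [|w p IHp] u uB /=; first by rewrite connect0.
move=> /andP[/[dup] euw /and3P[uX wX uw] pw].
have wB : w \in B by rewrite (inQ _ _ _ BQ uB) wX connect1.
by apply: connect_trans (connect1 _) (IHp _ wB pw); rewrite /= uB wB.
Qed.

End ModuleComponents.

Section CanonicalPartition.
Variables (V : finType) (G : sgraph V).
Hypothesis conG : graph_connected G.
Implicit Types A B X : {set V}.
Local Open Scope set_scope.
Local Notation P := (canonical_partition G).
Local Notation coG := (complement_graph G).

Lemma graph_componentP (H : sgraph V) A u :
  A \in graph_components H -> u \in A -> A = [set v | connect H u v].
Proof.
have cs : connect_sym H by exact: sym_connect_sym (@adj_sym _ H).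
move=> /imsetP[w _ ->]; rewrite inE => wu; apply/setP => v; rewrite !inE.
by apply/idP/idP; apply: connect_trans; rewrite // cs.
Qed.

Lemma component_module A : A \in graph_components coG -> is_module G A.
Proof.
move=> AP; apply/is_moduleP => i j k iA jA kA.
have adjk l : l \in A -> G l k.
  move=> lA; apply: contraNT (kA) => lk.
  rewrite (graph_componentP AP lA) inE connect1//= lk andbT.
  by apply: contraNneq kA => <-.
by rewrite !adjk.
Qed.

(** Two overlapping modules have a module as union, so by maximality only a union equal to the whole
    vertex set is a threat. In that case all pairs across the cut of [B] have the same adjacency,
    and either [G] or its complement has no edge there. *)
Lemma maximal_proper_modules_disjoint A B x : graph_connected coG ->
  maxset (proper_module G) A -> maxset (proper_module G) B ->
  x \in A -> x \in B -> A = B.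
Proof.
move=> conc /maxsetP[/andP[/is_moduleP mA AT] maxA] /maxsetP[/andP[/is_moduleP
  mB BT] maxB] xA xB.
have mU : is_module G (A :|: B).
  apply/is_moduleP => i j k iU jU; rewrite inE negb_or => /andP[kA kB].
  suff E l : l \in A :|: B -> G l k = G x k by rewrite !E.
  by rewrite inE => /orP[lA|lB]; [apply: mA|apply: mB].
have [UT|UT] := eqVneq (A :|: B) [set: V]; last first.
  have pU : proper_module G (A :|: B) by rewrite /proper_module mU.
  by rewrite -(maxA _ pU (finset.subsetUl _ _)) -{2}(maxB _ pU (finset.subsetUr
    _ _)).
have notin (C : {set V}) : C != [set: V] -> exists t, t \notin C.
  move=> CT; apply/existsP; apply: contra_neqT CT => /existsPn CT.
  by apply/setP => t; rewrite inE; apply/negPn/CT.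
have [t tA] := notin _ AT; have [s sB] := notin _ BT.
have covered k : k \notin A -> k \in B.
  by move=> kA; have : k \in A :|: B by [rewrite UT inE];
    rewrite inE (negPf kA).
have cut i j : i \notin B -> j \in B -> G i j = G x t.
  move=> iB jB; have iA : i \in A by apply: contraNT iB; exact: covered.
  by rewrite (adj_sym G) (mB _ t i)// ?covered// adj_sym; apply: mA.
have [a [b [aB bB Gab]]] : exists a b, [/\ a \in ~: B, b \notin ~: B & G a b].
  by apply: (@connected_cut _ _ _ s x) => //; rewrite !inE ?xB.
have [a' [b' [a'B b'B Gab']]] : exists a b, [/\ a \in ~: B,
  b \notin ~: B & coG a b].
  by apply: (@connected_cut _ _ _ s x) => //; rewrite !inE ?xB.
move: aB bB a'B b'B Gab Gab'; rewrite !inE !negbK /= => aB bB a'B b'B.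
by rewrite !cut// => ->; rewrite andbF.
Qed.

Lemma block_unique A B x : A \in P -> B \in P -> x \in A -> x \in B -> A = B.
Proof.
rewrite /canonical_partition; case: ifP => [conc|_].
  by rewrite !inE; exact: maximal_proper_modules_disjoint.
move=> AP BP xA xB.
by rewrite (graph_componentP AP xA) (graph_componentP BP xB).
Qed.

Lemma block_module A : A \in P -> is_module G A.
Proof.
rewrite /canonical_partition; case: ifP => [conc|_];
  last exact: component_module.
by rewrite inE => /maxsetp/andP[].
Qed.

Lemma block_proper A : A \in P -> A != [set: V].
Proof.
rewrite /canonical_partition; case: ifP => [conc|/negP disc].
  by rewrite inE => /maxsetp/andP[].
move=> AP; apply/negP => /eqP AT; apply: disc; apply/andP; split.
  by case/andP: conG.
apply/'forall_forallP => u v.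
have uA : u \in A by rewrite AT inE.
have : v \in A by rewrite AT inE.
by rewrite (graph_componentP AP uA) inE.
Qed.

Lemma same_blockP u v :
  reflect (exists A, [/\ A \in P, u \in A & v \in A]) (same_block P u v).
Proof.
apply: (iffP existsP) => -[A]; first by move=> /and3P[]; exists A.
by move=> [AP uA vA]; exists A; rewrite AP uA.
Qed.

Lemma same_block_sym : symmetric (same_block P).
Proof.
by move=> u v; apply: eq_existsb => A; congr (_ && _); rewrite andbC.
Qed.

Lemma same_block_trans : transitive (same_block P).
Proof.
move=> v u w /same_blockP[A [AP uA vA]] /same_blockP[B [BP vB wB]].
apply/same_blockP; exists A; split=> //.
by rewrite (block_unique AP BP vA vB).
Qed.

Lemma same_block_adj u v w :
  same_block P u v -> ~~ same_block P u w -> G u w = G v w.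
Proof.
move=> /same_blockP[A [AP uA vA]] uw.
have /is_moduleP mA := block_module AP; apply: mA => //.
by apply: contra uw => wA; apply/same_blockP; exists A.
Qed.

Lemma copartition_edge : 1 < #|V| -> exists u v, copartition G P u v.
Proof.
move=> V1; have [/existsP[u /existsP[v uv]]|no] :=
  boolP [exists u, exists v, copartition G P u v]; first by exists u, v.
have sb u v : G u v -> same_block P u v.
  move=> uv; apply: contraNT no => nuv.
  by apply/existsP; exists u; apply/existsP; exists v; rewrite /= uv.
have /card_gt1P[x [y [_ _ xy]]] := V1.
(* Blocks are not known here to cover the vertices; an edge at [x] provides a block containing
   [x]. *)
have [a [b [/set1P-> _ xb]]] : exists a b, [/\ a \in [set x],
  b \notin [set x] & G a b].
  by apply: (@connected_cut _ G [set x] x y); rewrite // inE// eq_sym.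
have /same_blockP[A [AP xA _]] := sb _ _ xb.
have [t tA] : exists t, t \notin A.
  apply/existsP; apply: contra_neqT (block_proper AP) => /existsPn CT.
  by apply/setP => t; rewrite inE; apply/negPn/CT.
have [c [d [cA dA cd]]] := connected_cut conG xA tA.
have /same_blockP[B [BP cB dB]] := sb _ _ cd.
by rewrite (block_unique AP BP cA cB) dB in dA.
Qed.

(** The orientation between blocks and the one inside blocks can be chosen independently. A crossing
    arc composed with an inner arc has adjacent ends because blocks are modules; if that edge
    pointed backwards, transitivity of [O'] would give an arc of [O'] inside a block. *)
Lemma extend_transitive_orientation O' O :
  transitive_orientation (copartition G P) O' -> transitive_orientation G O ->
  transitive_orientation G [set p | (p \in O') || (same_block P p.1 p.2 && (p
    \in O))].
Proof.
move=> /transitive_orientationP[OG' GO' tr'] /transitive_orientationP[OG GO tr].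
pose lt := [rel u v | ((u, v) \in O') || (same_block P u v && ((u, v) \in O))].
have nsb u v : (u, v) \in O' -> ~~ same_block P u v by move=> /OG'/andP[].
have -> : [set p | (p \in O') || (same_block P p.1 p.2 && (p \in O))] =
  [set p | lt p.1 p.2].
  by apply/setP => -[u v]; rewrite !inE.
apply: (@transitive_orientation_rel _ G lt) => [u|v u w|u v].
- apply/negP => /orP[/OG'|/andP[_ /OG]]; rewrite /= ?adj_irr//.
- move=> /orP[uv|/andP[suv uv]] /orP[vw|/andP[svw vw]].
  + by apply/orP; left; apply: tr' uv vw.
  + have suw : ~~ same_block P u w.
      by apply: contra (nsb _ _ uv) => suw; apply: same_block_trans suw _;
        rewrite same_block_sym.
    have : copartition G P u w.
      have /andP[Guv _] := OG' _ _ uv.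
      rewrite /= suw andbT adj_sym -(same_block_adj svw) 1?adj_sym//.
      by rewrite same_block_sym nsb.
    move=> /GO'; case uw : ((u, w) \in O'); first by move=> _; apply/orP; left.
    move=> /= wu; have := nsb _ _ (tr' _ _ _ wu uv).
    by rewrite same_block_sym svw.
  + have suw : ~~ same_block P u w.
      apply: contra (nsb _ _ vw) => suw.
      by apply: same_block_trans suw; rewrite same_block_sym.
    have : copartition G P u w.
      have /andP[Gvw _] := OG' _ _ vw.
      by rewrite /= suw andbT (same_block_adj suv).
    move=> /GO'; case uw : ((u, w) \in O'); first by move=> _; apply/orP; left.
    move=> /= wu; have := nsb _ _ (tr' _ _ _ vw wu).
    by rewrite same_block_sym suv.
  + by apply/orP; right; rewrite (same_block_trans suv svw)//; apply: tr uv vw.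
- rewrite /= (same_block_sym v u); have [suv|nsuv] := boolP (same_block P u v).
    have no a b : same_block P a b -> (a, b) \in O' = false.
      by move=> sab; apply: contraTF sab => /nsb.
    rewrite !no ?(same_block_sym v)//=; apply/idP/orP => [/GO|[/OG//|/OG]].
      by case: (_ \in O) => //= vu; [left|right].
    by rewrite adj_sym.
  rewrite !orbF; apply/idP/orP => [Guv|[/OG'/andP[]//|/OG'/andP[]]].
    have /GO' : copartition G P u v by rewrite /= Guv.
    by case: (_ \in O') => //= vu; [left|right].
  by rewrite adj_sym.
Qed.



End CanonicalPartition.

Local Open Scope classical_set_scope.
Local Open Scope ring_scope.

(** * Spectral theory of symmetric matrices and Laplacians *)

Section DotProduct.
Variables (R : realType) (n : nat).
Implicit Types (x y z : 'cV[R]_n) (A : 'M[R]_n).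

Definition dot x y : R := \sum_i x i 0 * y i 0.

Lemma dotC x y : dot x y = dot y x.
Proof. by apply: eq_bigr => i _; rewrite mulrC. Qed.

Lemma dotDr x y z : dot x (y + z) = dot x y + dot x z.
Proof. by rewrite -big_split; apply: eq_bigr => i _; rewrite mxE mulrDr. Qed.

Lemma dotZr a x y : dot x (a *: y) = a * dot x y.
Proof. by rewrite mulr_sumr; apply: eq_bigr => i _; rewrite mxE mulrCA. Qed.

Lemma dotDl x y z : dot (x + y) z = dot x z + dot y z.
Proof. by rewrite dotC dotDr !(dotC z). Qed.

Lemma dotZl a x y : dot (a *: x) y = a * dot x y.
Proof. by rewrite dotC dotZr dotC. Qed.

Lemma dotNr x y : dot x (- y) = - dot x y.
Proof. by rewrite -scaleN1r dotZr mulN1r. Qed.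

Lemma dotNl x y : dot (- x) y = - dot x y.
Proof. by rewrite dotC dotNr dotC. Qed.

Lemma dotBr x y z : dot x (y - z) = dot x y - dot x z.
Proof. by rewrite dotDr dotNr. Qed.

Lemma dotBl x y z : dot (x - y) z = dot x z - dot y z.
Proof. by rewrite dotDl dotNl. Qed.

Lemma dot0r x : dot x 0 = 0.
Proof. by rewrite /dot big1// => i _; rewrite mxE mulr0. Qed.

Lemma dot_sumr (I : finType) x (F : I -> 'cV[R]_n) :
  dot x (\sum_s F s) = \sum_s dot x (F s).
Proof.
by apply: (big_morph (dot x)) => [y z|]; [exact: dotDr | exact: dot0r].
Qed.

Lemma dotE x y : x^T *m y = (dot x y)%:M.
Proof.
apply/matrixP => i j; rewrite !ord1 !mxE eqxx mulr1n.
by apply: eq_bigr => k _; rewrite mxE.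
Qed.

Lemma dot_mulmx A x y : dot x (A *m y) = dot (A^T *m x) y.
Proof.
have : (dot x (A *m y))%:M = (dot (A^T *m x) y)%:M :> 'M[R]_1.
  by rewrite -!dotE trmx_mul trmxK mulmxA.
by move=> /matrixP/(_ 0 0); rewrite !mxE !mulr1n.
Qed.

Lemma dot_ge0 x : 0 <= dot x x.
Proof. by apply: sumr_ge0 => i _; rewrite -expr2 sqr_ge0. Qed.

Lemma dot_eq0 x : (dot x x == 0) = (x == 0).
Proof.
apply/idP/eqP => [|->]; last by rewrite dot0r.
rewrite psumr_eq0 => [/allP h|i _]; last by rewrite -expr2 sqr_ge0.
apply/matrixP => i j; rewrite ord1 mxE.
by have := h i (mem_index_enum _); rewrite mulf_eq0 orbb => /eqP.
Qed.

Lemma dot_gt0 x : (0 < dot x x) = (x != 0).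
Proof. by rewrite lt0r dot_eq0 dot_ge0 andbT. Qed.

End DotProduct.

Section Spectral.
Variables (R : realType) (n : nat) (A : 'M[R]_n).
Hypothesis symA : A^T = A.

(* The real and imaginary parts of an orthonormal eigenbasis of A over the
   complex numbers are eigenvectors of A, and they form a Parseval frame of
   R^n. *)
Lemma eigenframe : exists (d : 'I_n * bool -> R) (u : 'I_n * bool -> 'cV[R]_n),
  (forall s, A *m u s = d s *: u s) /\
  forall x, x = \sum_s dot (u s) x *: u s.
Proof.
pose toC := complex.real_complex R.
pose Ac := map_mx toC A.
have conjE (z : complex.complex R) : Num.conj z = complex.conjc z by [].
have hA : Ac \is hermsymmx.
  apply: realsym_hermsym.
    apply/is_hermitianmxP; rewrite expr0 scale1r map_mx_id//.
    by rewrite /Ac map_trmx symA.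
  apply/mxOverP => i j; rewrite mxE; apply/CrealP.
  by rewrite conjE complex.conjc_real.
have /mxOverP rd := hermitian_spectral_diag_real hA.
have /orthomx_spectralP := hermitian_normalmx hA.
have := spectral_unitarymx Ac.
move: (spectralmx Ac) (spectral_diag Ac) rd => P D rd Pu;
  rewrite invmx_unitary// => AE.
pose d l := complex.Re (D 0 l).
have dE l : D 0 l = toC (d l).
  have /CrealP := rd 0 l; rewrite conjE /d.
  case: (D 0 l) => a b /= [] /eqP; rewrite eq_sym -subr_eq0 opprK.
  by rewrite -mulr2n mulrn_eq0/= => /eqP->.
pose Q := map_mx Num.conj P^T.
have PQ : P *m Q = 1%:M by apply/unitarymxP.
have QP : Q *m P = 1%:M by exact: mulmx1C.
have AQ : Ac *m Q = Q *m diag_mx D.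
  by rewrite AE -!mulmxA PQ mulmx1.
have ev i l : \sum_j toC (A i j) * complex.conjc (P l j) =
  complex.conjc (P l i) * toC (d l).
  have /matrixP/(_ i l) := AQ; rewrite mul_mx_diag !mxE -dE => <-.
  by apply: eq_bigr => j _; rewrite !mxE.
have ReM (F : 'I_n -> complex.complex R) :
    complex.Re (\sum_j F j) = \sum_j complex.Re (F j).
  by apply: (big_rec2 (fun z r => complex.Re z = r)) => // j z r _ <-;
    case: (F j) z => ? ? [].
have ImM (F : 'I_n -> complex.complex R) :
    complex.Im (\sum_j F j) = \sum_j complex.Im (F j).
  by apply: (big_rec2 (fun z r => complex.Im z = r)) => // j z r _ <-;
    case: (F j) z => ? ? [].
exists (fun s => d s.1).
exists (fun s => \col_i (if s.2 then complex.Re (P s.1 i) else complex.Im (P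
  s.1 i))).
split=> [[l b]|x] /=; apply/matrixP => i j; rewrite ord1 ?mxE {j}.
  under eq_bigr do rewrite mxE.
  have := ev i l; case: b.
    move=> /(congr1 (@complex.Re R)); rewrite ReM /= => E.
    rewrite (_ : d l * _ = complex.Re (complex.conjc (P l i) * toC (d l)));
      last first.
      by case: (P l i) => a b /=; rewrite mulr0 subr0 mulrC.
    rewrite -E; apply: eq_bigr => k _.
    by case: (P l k) => a b /=; rewrite mul0r subr0.
  move=> /(congr1 (@complex.Im R)); rewrite ImM /= => E.
  apply: oppr_inj; rewrite (_ : - (d l * _) = complex.Im (complex.conjc (P l i)
    * toC (d l))); last first.
    by case: (P l i) => a b /=; rewrite mulr0 add0r; ring.
  rewrite -E -sumrN; apply: eq_bigr => k _.
  by case: (P l k) => a b /=; rewrite mul0r addr0 mulrN.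
(* The real part of [Q *m P = 1%:M] is exactly the Parseval identity of the frame. *)
have orth k : \sum_l (complex.Re (P l i) * complex.Re (P l k) + complex.Im (P l
  i) * complex.Im (P l k)) = (i == k)%:R.
  have /matrixP/(_ i k)/(congr1 (@complex.Re R)) := QP; rewrite !mxE ReM.
  rewrite (_ : complex.Re _ = (i == k)%:R); last by case: (i == k).
  move=> <-; apply: eq_bigr => l _; rewrite !mxE conjE.
  by case: (P l i) (P l k) => a b [c e] /=; ring.
rewrite summxE.
under eq_bigr do rewrite !mxE.
transitivity (\sum_k (i == k)%:R * x k 0).
  rewrite (bigD1 i)//= eqxx mul1r big1 ?addr0// => k /negPf ki.
  by rewrite eq_sym ki mul0r.
rewrite (eq_bigr (fun k => \sum_l (complex.Re (P l i) * complex.Re (P l k) +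
  complex.Im (P l i) * complex.Im (P l k)) * x k 0)); last first.
  by move=> k _; rewrite -mulr_suml orth.
rewrite exchange_big/=.
rewrite -(pair_bigA _ (fun l b => dot (\col_i0 (if b then complex.Re (P l i0)
  else complex.Im (P l i0))) x *
   (if b then complex.Re (P l i) else complex.Im (P l i))))/=.
apply: eq_bigr => l _; rewrite big_bool /= /dot !mulr_suml -big_split/=.
by apply: eq_bigr => k _; rewrite !mxE; ring.
Qed.

End Spectral.

(** After division by [lam ^+ k], the terms with [d s < lam] tend to 0 and the limit is the sum in
    the conclusion. *)
Lemma dominant_sum_ge0 (R : realType) (I : finType) (c d : I -> R) (lam : R) :
  (forall s, c s != 0 -> 0 <= d s <= lam) ->
  (forall k, 0 <= \sum_s c s * d s ^+ k) ->
  0 <= \sum_(s | d s == lam) c s.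
Proof.
move=> cd sum_ge0.
(* If [lam <= 0], every index with [c s != 0] has [d s = lam], and the hypothesis at [k = 0] is
   already the claim. *)
have [lam_gt0|lam_le0] := ltP 0 lam; last first.
  have := sum_ge0 0%N; rewrite (bigID (fun s => d s == lam))/= addrC big1
    ?add0r.
    by under eq_bigr do rewrite expr0 mulr1.
  move=> s; have [-> _|/cd /andP[d0 dl]] := eqVneq (c s) 0;
    first by rewrite mul0r.
  by rewrite eq_le dl (le_trans lam_le0 d0).
pose u k := \sum_s (if c s == 0 then 0 else c s * (d s / lam) ^+ k).
have cu : u @ \oo --> \sum_s (if d s == lam then c s else 0).
  apply: cvg_big => [|s _]; first exact: add_continuous.
  have [->|cs0] := eqVneq (c s) 0.
    by rewrite if_same; exact: cvg_cst.
  have [->|dl] := eqVneq (d s) lam.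
    rewrite divff ?gt_eqF//; under eq_fun do rewrite expr1n mulr1.
    exact: cvg_cst.
  rewrite -[X in _ --> X](mulr0 (c s)); apply: cvgMl_tmp; apply: cvg_expr.
  have /andP[d0 dl'] := cd s cs0.
  have r0 : 0 <= d s / lam by rewrite divr_ge0// ltW.
  by rewrite (ger0_norm r0) ltr_pdivrMr// mul1r lt_neqAle dl.
rewrite big_mkcond -(cvg_lim _ cu)//.
apply: limr_ge; first by apply/cvg_ex; eexists; exact: cu.
apply: nearW => k; rewrite /u.
suff -> : \sum_s (if c s == 0 then 0 else c s * (d s / lam) ^+ k) =
    (\sum_s c s * d s ^+ k) / lam ^+ k.
  by rewrite divr_ge0// exprn_ge0// ltW.
rewrite mulr_suml; apply: eq_bigr => s _; case: eqP => [->|_].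
  by rewrite !mul0r.
by rewrite expr_div_n mulrA.
Qed.

Section LargestEigenvalue.
Variables (R : realType) (n : nat) (A : 'M[R]_n) (lam : R).
Hypotheses (symA : A^T = A) (lamP : largest_eigenvalue A lam).
Implicit Types x y : 'cV[R]_n.

Lemma eigenvector_le x a : A *m x = a *: x -> x != 0 -> a <= lam.
Proof.
move=> Ax x0; apply: lamP.2; apply/eigenvalueP; exists x^T.
  by rewrite -{1}symA -trmx_mul Ax linearZ.
by rewrite -trmx0 (inj_eq trmx_inj).
Qed.

Lemma eigenvector_ex : exists2 x : 'cV[R]_n, A *m x = lam *: x & x != 0.
Proof.
have /eigenvalueP[v vA v0] := lamP.1; exists v^T.
  by rewrite -{1}symA -trmx_mul vA linearZ.
by rewrite -trmx0 (inj_eq trmx_inj).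
Qed.

Lemma rayleigh_le x : dot x (A *m x) <= lam * dot x x.
Proof.
have [d [u [Au xE]]] := eigenframe symA.
have AxE : A *m x = \sum_s (d s * dot (u s) x) *: u s.
  rewrite {1}[x]xE mulmx_sumr; apply: eq_bigr => s _.
  by rewrite -scalemxAr Au scalerA mulrC.
have xxE : dot x x = \sum_s dot (u s) x * dot (u s) x.
  rewrite {2}[x]xE dot_sumr; apply: eq_bigr => s _.
  by rewrite dotZr (dotC x).
rewrite AxE xxE dot_sumr mulr_sumr; apply: ler_sum => s _.
rewrite !dotZr (dotC x) -mulrA.
have [u0|u0] := eqVneq (u s) 0; first by rewrite u0 dotC dot0r !mulr0.
by apply: ler_wpM2r; [rewrite -expr2 sqr_ge0 | exact: eigenvector_le (Au s) u0].
Qed.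

(* p is the orthogonal projection on the eigenspace of lam, that is the limit
   of the powers of A / lam. *)
Lemma top_projection : (forall x, 0 <= dot x (A *m x)) ->
  exists p : 'cV[R]_n -> 'cV[R]_n,
    [/\ forall x, A *m p x = lam *: p x,
        forall x, A *m x = lam *: x -> p x = x,
        forall x y, p (x - y) = p x - p y
      & forall x i j, (forall k, iter k (mulmx A) x i 0 <= iter k (mulmx A) x j
        0) ->
          p x i 0 <= p x j 0].
Proof.
move=> psd; have [d [u [Au xE]]] := eigenframe symA.
have d_bounds s : u s != 0 -> 0 <= d s <= lam.
  move=> u0; rewrite (eigenvector_le (Au s) u0) andbT.
  by have := psd (u s); rewrite Au dotZr pmulr_lge0// dot_gt0.
exists (fun x => \sum_(s | d s == lam) dot (u s) x *: u s); split.
- move=> x; rewrite mulmx_sumr scaler_sumr; apply: eq_bigr => s /eqP ds.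
  by rewrite -scalemxAr Au ds !scalerA mulrC.
- move=> x Ax; rewrite [RHS]xE [RHS](bigID (fun s => d s == lam))/=.
  rewrite [X in _ = _ + X]big1 ?addr0// => s dl.
  have : lam * dot (u s) x = d s * dot (u s) x.
    by rewrite -dotZr -Ax dot_mulmx symA Au dotZl.
  move/eqP; rewrite -subr_eq0 -mulrBl mulf_eq0 subr_eq0 eq_sym (negPf dl).
  by move=> /eqP ->; rewrite scale0r.
- move=> x y; rewrite -sumrB; apply: eq_bigr => s _.
  by rewrite dotBr scalerBl.
- move=> x i j le_ij; rewrite !summxE -subr_ge0 -sumrB.
  have iterE k : iter k (mulmx A) x = \sum_s (dot (u s) x * d s ^+ k) *: u s.
    elim: k => [|k IHk] /=.
      by rewrite {1}[x]xE; apply: eq_bigr => s _; rewrite expr0 mulr1.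
    rewrite IHk mulmx_sumr; apply: eq_bigr => s _.
    by rewrite -scalemxAr Au scalerA -mulrA -exprSr.
  apply: dominant_sum_ge0 => [s|k].
    have [->|/d_bounds//] := eqVneq (u s) 0.
    by rewrite !mxE !mulr0 subrr eqxx.
  have := le_ij k; rewrite iterE !summxE -subr_ge0 -sumrB.
  under eq_bigr do rewrite !mxE -mulrBr mulrAC.
  by under [X in _ -> _ <= X]eq_bigr do rewrite !mxE -mulrBr.
Qed.

End LargestEigenvalue.

Section Laplacian.
Variables (R : realType) (n : nat) (G : sgraph 'I_n).
Implicit Types x y : 'cV[R]_n.
Local Notation L := (laplacian R G).

Lemma laplacian_sym : L^T = L.
Proof.
apply/matrixP => i j; rewrite !mxE eq_sym; case: eqP => [->//|_].
by rewrite adj_sym.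
Qed.

Lemma laplacianE x i : (L *m x) i 0 = \sum_(k | G i k) (x i 0 - x k 0).
Proof.
rewrite sumrB mxE (bigD1 i)//= !mxE eqxx sumr_const mulr_natl.
congr (_ *+ _ + _); first by apply: eq_card => k; rewrite !inE.
rewrite (bigID (fun k => G i k)) /= addrC big1 ?add0r =>
  [|k /andP[ki /negPf Gik]].
  rewrite -sumrN; apply: eq_big => [k|k /andP[ki Gik]].
    by case: eqP => //= ->; rewrite adj_irr.
  by rewrite mxE eq_sym (negPf ki) Gik mulN1r.
by rewrite mxE eq_sym (negPf ki) Gik mul0r.
Qed.

(** The polarized Dirichlet form; each edge occurs in both directions, whence the factor 2. *)
Lemma laplacian_dot x y : 2 * dot x (L *m y) =
  \sum_i \sum_(k | G i k) (x i 0 - x k 0) * (y i 0 - y k 0).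
Proof.
have E1 : dot x (L *m y) = \sum_i \sum_(k | G i k) x i 0 * (y i 0 - y k 0).
  by apply: eq_bigr => i _; rewrite laplacianE mulr_sumr.
have E2 : dot x (L *m y) = \sum_i \sum_(k | G i k) x k 0 * (y k 0 - y i 0).
  rewrite E1 [RHS](exchange_big_dep xpredT)//=.
  by apply: eq_bigr => i _; apply: eq_bigl => k; rewrite adj_sym.
rewrite mulr_natl mulr2n {1}E1 E2 -big_split; apply: eq_bigr => i _.
by rewrite -big_split; apply: eq_bigr => k _ /=; ring.
Qed.

Lemma laplacian_psd x : 0 <= dot x (L *m x).
Proof.
rewrite -(pmulr_rge0 _ (ltr0n R 2)) laplacian_dot.
by do 2 apply: sumr_ge0 => ? _; rewrite -expr2 sqr_ge0.
Qed.

End Laplacian.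

(** * The top eigenspace and the cones of transitive orientations *)

Section Cones.
Variables (R : realType) (n : nat) (G : sgraph 'I_n) (O : {set 'I_n * 'I_n}).
Hypothesis tO : transitive_orientation G O.
Implicit Types x y : 'cV[R]_n.
Local Notation L := (laplacian R G).

(** The value 0 on non-edges lets two rows of the Laplacian be compared summand by summand over the
    same index set. *)
Definition edge_diff x (i k : 'I_n) : R := if G i k then x i 0 - x k 0 else 0.

Lemma laplacian_edge_diff x i : (L *m x) i 0 = \sum_k edge_diff x i k.
Proof. by rewrite laplacianE big_mkcond. Qed.

(** A vertex [k] adjacent to [i] but not to [j] must lie above [i], since an arc from [k] to [i]
    would compose to an edge between [k] and [j]. Symmetrically, a vertex adjacent to [j] only lies
    below [j]. *)
Lemma edge_diff_le x i j k : cone O x -> (i, j) \in O ->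
  edge_diff x i k <= edge_diff x j k.
Proof.
have /transitive_orientationP[OG GO tr] := tO.
move=> cx ij; rewrite /edge_diff.
case: ifPn => ik; case: ifPn => jk //.
- by rewrite lerD2r; apply: cx.
- rewrite subr_le0; apply: cx.
  have := GO _ _ ik; case: ((i, k) \in O) => //= ki.
  by move: jk; rewrite adj_sym (OG k j)//; apply: tr ki ij.
- rewrite subr_ge0; apply: cx.
  have := GO _ _ jk; case jk' : ((j, k) \in O) => //= _.
  by move: ik; rewrite (OG i k)//; apply: tr ij jk'.
Qed.

Lemma cone_laplacian x : cone O x -> cone O (L *m x).
Proof.
move=> cx i j ij; rewrite !laplacian_edge_diff; apply: ler_sum => k _.
exact: edge_diff_le.
Qed.

Lemma cone_iter_laplacian x k : cone O x -> cone O (iter k (mulmx L) x).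
Proof. by move=> cx; elim: k => //= k; exact: cone_laplacian. Qed.

(* Equal coordinates at the ends of an arc turn the termwise inequality
   between two equal coordinates of lam *: x into equalities. *)
Lemma fiber_neighbours lam x i j k :
  cone O x -> L *m x = lam *: x -> G i j -> x i 0 = x j 0 ->
  G i k -> ~~ G j k -> x k 0 = x i 0.
Proof.
have /transitive_orientationP[_ GO _] := tO.
move=> cx Lx Gij xij ik jk.
have eq_arc u v : (u, v) \in O -> x u 0 = x v 0 -> edge_diff x u k =
  edge_diff x v k.
  move=> uv xuv; have /eqP : \sum_l (edge_diff x v l - edge_diff x u l) = 0.
    by rewrite sumrB -!laplacian_edge_diff Lx !mxE xuv subrr.
  rewrite psumr_eq0; last by move=> l _; rewrite subr_ge0; apply: edge_diff_le.
  by move=> /allP h; have := h k (mem_index_enum k);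
    rewrite subr_eq0 => /eqP ->.
have : edge_diff x i k = edge_diff x j k.
  have := GO _ _ Gij; case ij : ((i, j) \in O); first by move=> _;
    apply: eq_arc.
  by move=> /= ji; apply/esym/eq_arc.
by rewrite /edge_diff ik (negPf jk) => /eqP; rewrite subr_eq0 => /eqP.
Qed.

Lemma fiber_modules lam x xi : comparability_graph G ->
  cone O x -> L *m x = lam *: x -> fiber x xi ->
  exists Q : {set {set 'I_n}}, induced_disjoint_union G xi Q /\
    forall B, B \in Q ->
      [/\ is_module G B, graph_connected (induced_subgraph G B)
        & comparability_graph (induced_subgraph G B)].
Proof.
move=> compG cx Lx [a xiP].
have [Q [QX Qm]] : exists Q : {set {set 'I_n}}, induced_disjoint_union G xi Q /\
    forall B, B \in Q -> is_module G B /\ graph_connected (induced_subgraph G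
      B).
  apply: module_components => i j k /xiP xi_a /xiP xj_a Gij Gik Gjk.
  by apply/xiP; rewrite (fiber_neighbours cx Lx Gij _ Gik Gjk)// xj_a.
exists Q; split=> // B /Qm[mB cB]; split=> //.
exact: induced_comparability_graph.
Qed.

Lemma cone_eigenvector_diff lam v : largest_eigenvalue L lam ->
  L *m v = lam *: v ->
  exists a b, [/\ cone O a, L *m a = lam *: a, cone O b, L *m b = lam *: b & v =
    a - b].
Proof.
move=> lamP Lv; have /transitive_orientationP[OG GO tr] := tO.
have [p [pE pid pB ple]] := top_projection (laplacian_sym R G) lamP
  (laplacian_psd G).
have pcone x : cone O x -> cone O (p x).
  by move=> cx i j ij; apply: ple => k; apply: cone_iter_laplacian.
(* Counting predecessors gives an interior point of the cone: it grows by at least 1 along every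
   arc. *)
pose h : 'cV[R]_n := \col_i #|[set j | (j, i) \in O]%SET|%:R.
have h_incr i j : (i, j) \in O -> h i 0 + 1 <= h j 0.
  move=> ij; rewrite !mxE natr1 ler_nat; apply: proper_card.
  apply/properP; split; first by apply/fintype.subsetP => k;
    rewrite !inE => /tr; apply.
  by exists i; rewrite !inE//; apply/negP => /OG; rewrite adj_irr.
(* This bounds every difference of two coordinates of [v], so [N *: h] outweighs any descent of [v]
   along an arc. *)
pose N : R := \sum_i `|v i 0| + \sum_i `|v i 0|.
have N0 : 0 <= N by rewrite addr_ge0// sumr_ge0.
have vN i : `|v i 0| <= \sum_i `|v i 0|.
  by rewrite (bigD1 i)//= lerDl sumr_ge0.
have cNh : cone O (N *: h).
  move=> i j ij; rewrite !mxE; apply: ler_wpM2l => //.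
  by have := h_incr _ _ ij; rewrite !mxE; lra.
have cvNh : cone O (v + N *: h).
  move=> i j ij; have hij := h_incr _ _ ij.
  rewrite [(v + _) i 0]mxE [(v + _) j 0]mxE [(N *: h) i 0]mxE [(N *: h) j 0]mxE.
  have := vN i; have := vN j; rewrite !ler_norml => /andP[+ _] /andP[_ +].
  have : N <= N * (h j 0 - h i 0) by rewrite ler_peMr// lerBrDl.
  by rewrite /N; lra.
exists (p (v + N *: h)), (p (N *: h)); split=> //; try exact: pcone.
by rewrite -pB addrK pid.
Qed.

End Cones.

Section LinSpan.
Variables (R : realType) (n : nat) (G : sgraph 'I_n) (lam : R).
Local Notation L := (laplacian R G).
Local Notation E := (col_eigenspace L lam).

Lemma mem_span_eigenspace v : v \in lin_span E <-> E v.
Proof.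
split=> [|Ev]; last by have [+ _] := lin_spanP E; apply.
pose K : {vspace 'cV[R]_n} := lker (linfun (mulmx (L - lam%:M))).
have kerE u : (u \in K) = (L *m u == lam *: u).
  by rewrite memv_ker lfunE /= mulmxBl mul_scalar_mx subr_eq0.
have [_ minE] := lin_spanP E.
have /subvP sub : (lin_span E <= K)%VS.
  by apply: minE => u Eu; rewrite kerE; apply/eqP.
by move=> /sub; rewrite kerE => /eqP.
Qed.

Lemma dim_cone_eigenspace O : transitive_orientation G O ->
  largest_eigenvalue L lam -> dim_linspan (cone O `&` E) = dim_linspan E.
Proof.
move=> tO lamP; congr (\dim _); apply/eqP; rewrite eqEsubv; apply/andP; split.
  have [_ ->//] := lin_spanP (cone O `&` E) => v [_ Ev].
  exact/mem_span_eigenspace.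
have [_ ->//] := lin_spanP E => v Ev.
have [a [b [ca Ea cb Eb ->]]] := cone_eigenvector_diff tO lamP Ev.
have [sp _] := lin_spanP (cone O `&` E).
by apply: rpredB; apply: sp.
Qed.

End LinSpan.

Section Indicators.
Variables (R : realType) (n : nat).
Implicit Types (A B : {set 'I_n}) (x : 'cV[R]_n).

Lemma sum_indicator A : \sum_i (i \in A)%:R = #|A|%:R :> R.
Proof. by rewrite -sum1_card natr_sum [RHS]big_mkcond; apply: eq_bigr => i _;
  case: (i \in A). Qed.

(** This is the Dirichlet form of the complete graph, against which the form of [G] is compared
    below. *)
Lemma sum_square_differences x :
  \sum_i \sum_k (x i 0 - x k 0) ^+ 2 = 2 * (n%:R * dot x x - (\sum_i x i 0) ^+
    2).
Proof.
transitivity (\sum_i (n%:R * x i 0 ^+ 2 + dot x x - 2 * x i 0 * (\sum_k x k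
  0))).
  apply: eq_bigr => i _.
  transitivity (\sum_k (x i 0 ^+ 2 + x k 0 * x k 0 - 2 * x i 0 * x k 0)).
    by apply: eq_bigr => k _; ring.
  by rewrite sumrB big_split/= sumr_const card_ord -[_ *+ n]mulr_natl
    -mulr_sumr.
rewrite sumrB big_split/= sumr_const card_ord -mulr_sumr -mulr_suml -mulr_sumr.
have -> : \sum_i x i 0 ^+ 2 = dot x x by apply: eq_bigr => i _; rewrite expr2.
by rewrite -mulr_natl; ring.
Qed.

End Indicators.

(** * The top eigenspace when the complement is disconnected *)

Section CoDisconnected.
Variables (R : realType) (n : nat) (G : sgraph 'I_n) (lam : R).
Hypotheses (conG : graph_connected G)
  (disc : ~~ graph_connected (complement_graph G))
  (lamP : largest_eigenvalue (laplacian R G) lam).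
Implicit Types x y : 'cV[R]_n.
Local Notation L := (laplacian R G).
Local Notation E := (col_eigenspace L lam).
Local Notation P := (canonical_partition G).
Local Notation coG := (complement_graph G).

Lemma same_block_connect u v : same_block P u v = connect coG u v.
Proof.
have PE : P = graph_components coG by rewrite /canonical_partition (negPf disc).
apply/same_blockP/idP => [[A []]|uv].
  by rewrite PE => AP uA vA; move: vA; rewrite (graph_componentP AP uA) inE.
exists [set w | connect coG u w]%SET; rewrite PE imset_f// !inE.
by split=> //; exact: connect0.
Qed.

Lemma same_block_refl u : same_block P u u.
Proof. by rewrite same_block_connect connect0. Qed.

Lemma adjacent_across u v : ~~ same_block P u v -> G u v.
Proof.
rewrite same_block_connect => uv; apply: contraNT uv => nuv.
have [->|neq] := eqVneq u v; first exact: connect0.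
by apply: connect1; rewrite /= neq.
Qed.

(** Non-neighbours of a vertex lie in its block, where [x] does not vary; on such [x] the Laplacian
    acts like that of the complete graph. *)
Lemma block_eigenvector x :
  (forall u v, same_block P u v -> x u 0 = x v 0) -> \sum_i x i 0 = 0 ->
  L *m x = n%:R *: x.
Proof.
move=> xP x0; apply/matrixP => i j; rewrite ord1 laplacianE mxE {j}.
transitivity (\sum_k (x i 0 - x k 0)); last first.
  by rewrite sumrB x0 subr0 sumr_const card_ord mulr_natl.
rewrite big_mkcond; apply: eq_bigr => k _; case: ifPn =>
  // /(contraNT (@adjacent_across i k)).
by move=> /xP ->; rewrite subrr.
Qed.

(** Normalizing both indicators by block size makes the coordinates sum to zero. For distinct blocks
    the vector shows that [n] is an eigenvalue, and it separates the two blocks. *)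
Definition block_difference u v : 'cV[R]_n :=
  \col_i ((same_block P u i)%:R / #|[set w | same_block P u w]%SET|%:R
          - (same_block P v i)%:R / #|[set w | same_block P v w]%SET|%:R).

Lemma block_difference_eigenvector u v : L *m block_difference u v =
  n%:R *: block_difference u v.
Proof.
apply: block_eigenvector => [i j ij|].
  have e w : same_block P w i = same_block P w j.
    apply/idP/idP => h; apply: same_block_trans h _ => //.
    by rewrite same_block_sym.
  by rewrite !mxE !e.
under eq_bigr do rewrite mxE; rewrite sumrB -!mulr_suml.
have ind w : \sum_i (same_block P w i)%:R = #|[set w' |
  same_block P w w']%SET|%:R :> R.
  by rewrite -sum_indicator; apply: eq_bigr => i _; rewrite inE.
have card_neq0 w : #|[set w' | same_block P w w']%SET|%:R != 0 :> R.
  by rewrite pnatr_eq0 -lt0n; apply/card_gt0P; exists w;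
    rewrite inE same_block_refl.
by rewrite !ind !divff// subrr.
Qed.

Lemma block_difference_gt0 u v : ~~ same_block P u v ->
  block_difference u v v 0 < 0 < block_difference u v u 0.
Proof.
move=> uv; rewrite !mxE !same_block_refl (negPf uv) same_block_sym (negPf uv).
have card_gt0 w : 0 < #|[set w' | same_block P w w']%SET|%:R :> R.
  by rewrite ltr0n; apply/card_gt0P; exists w; rewrite inE same_block_refl.
by rewrite !mul0r !mul1r sub0r subr0 oppr_lt0 !invr_gt0 !card_gt0.
Qed.

Lemma block_difference_eq0 u v i : ~~ same_block P u i -> ~~ same_block P v i ->
  block_difference u v i 0 = 0.
Proof. by move=> /negPf ui /negPf vi; rewrite !mxE ui vi !mul0r subrr. Qed.

Lemma two_blocks : exists u v, ~~ same_block P u v.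
Proof.
have := disc; rewrite negb_and; case/andP: conG => -> _ /=.
move=> /forallPn[u /forallPn[v uv]].
by exists u, v; rewrite same_block_connect.
Qed.

(** The forms of [G] and of its complement add up to that of the complete graph. Since [lam] is at
    least [n], there is room neither for the complement's form [N] nor for the squared coordinate
    sum, so both vanish. *)
Lemma top_eigenvector_blocks x : E x ->
  (forall u v, same_block P u v -> x u 0 = x v 0) /\ \sum_i x i 0 = 0.
Proof.
move=> Ex; have lam_ge : n%:R <= lam.
  have [u [v uv]] := two_blocks.
  apply: (eigenvector_le (laplacian_sym R G) lamP (block_difference_eigenvector
    u v)).
  apply: contraTneq (block_difference_gt0 uv) => ->.
  by rewrite mxE ltxx.
pose N := \sum_i \sum_(k | ~~ G i k) (x i 0 - x k 0) ^+ 2.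
have N0 : 0 <= N by do 2 apply: sumr_ge0 => ? _; rewrite sqr_ge0.
have sum_eq : 2 * (lam * dot x x) + N = 2 * (n%:R * dot x x - (\sum_i x i 0) ^+
  2).
  rewrite -sum_square_differences -dotZr -Ex laplacian_dot -big_split/=.
  apply: eq_bigr => i _; rewrite [RHS](bigID (fun k => G i k))/=.
  by congr (_ + _); apply: eq_bigr => k _; rewrite expr2.
have le : n%:R * dot x x <= lam * dot x x by rewrite ler_wpM2r// dot_ge0.
have S0 : 0 <= (\sum_i x i 0) ^+ 2 by rewrite sqr_ge0.
have N00 : N = 0 by move: N0 sum_eq le S0; lra.
have S00 : (\sum_i x i 0) ^+ 2 = 0 by move: N0 sum_eq le S0; lra.
split; last by move/eqP: S00; rewrite sqrf_eq0 => /eqP.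
have nonadj u v : coG u v -> x u 0 = x v 0.
  move=> /andP[_ uv]; apply/eqP; rewrite -subr_eq0 -sqrf_eq0.
  move/eqP: N00; rewrite psumr_eq0 => [|i _]; last by apply: sumr_ge0 => k _;
    rewrite sqr_ge0.
  move=> /allP h; have := h u (mem_index_enum u);
    rewrite /= psumr_eq0 => [|i _]; last by rewrite sqr_ge0.
  by move=> /allP {}h; have := h v (mem_index_enum v); rewrite uv.
move=> u v; rewrite same_block_connect => /connectP[p + ->].
elim: p u => //= w p IHp u /andP[uw /IHp <-]; exact: nonadj.
Qed.

Lemma top_eigenvalue_card : lam = n%:R.
Proof.
have [x Lx x0] := eigenvector_ex (laplacian_sym R G) lamP.
have [xP xs] := top_eigenvector_blocks Lx.
have /matrixP := block_eigenvector xP xs; rewrite Lx => E0.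
apply/eqP; apply: contra_neqT x0 => lamn; apply/matrixP => i j;
  rewrite ord1 [RHS]mxE.
have := E0 i 0; rewrite !mxE => /eqP; rewrite -subr_eq0 -mulrBl mulf_eq0
  subr_eq0.
by rewrite (negPf lamn) => /eqP.
Qed.

Lemma eigenspace_blocks x : E x <->
  (forall u v, same_block P u v -> x u 0 = x v 0) /\ \sum_i x i 0 = 0.
Proof.
split; first exact: top_eigenvector_blocks.
by move=> [xP x0]; rewrite /col_eigenspace/= top_eigenvalue_card;
  exact: block_eigenvector.
Qed.

Lemma block_difference_eigenspace u v : E (block_difference u v).
Proof. by rewrite /col_eigenspace/= top_eigenvalue_card
  block_difference_eigenvector. Qed.

(** Vectors constant on blocks are the injective image of a space with one coordinate per block. The
    coordinate sum is a functional on it, nonzero at the all-ones vector, and rank-nullity removes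
    one dimension. *)
Lemma dim_eigenspace_blocks : dim_linspan E = (#|P| - 1)%N.
Proof.
have [u0 [v0 uv0]] := two_blocks.
pose block i := [set w | same_block P i w]%SET.
have blockP i : block i \in P.
  rewrite /canonical_partition (negPf disc); apply/imsetP; exists i => //.
  by apply/setP => w; rewrite !inE same_block_connect.
have blockE A i : A \in P -> i \in A -> A = block i.
  rewrite {1}/canonical_partition (negPf disc) => AP iA.
  by rewrite (graph_componentP AP iA); apply/setP => w;
    rewrite !inE same_block_connect.
have block_inh A : A \in P -> exists i, i \in A.
  rewrite /canonical_partition (negPf disc) => /imsetP[i _ ->].
  by exists i; rewrite inE connect0.
pose idx i : 'I_#|P| := enum_rank_in (blockP u0) (block i).
have idxE i j : (idx i == idx j) = same_block P i j.
  apply/eqP/idP => [/(congr1 enum_val)|ij].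
    by rewrite !enum_rankK_in// => /setP/(_ j); rewrite !inE same_block_refl.
  congr enum_rank_in; apply/setP => w; rewrite !inE.
  by apply/idP/idP; apply: same_block_trans; rewrite // same_block_sym.
have idx_surj a : exists i, idx i = a.
  have aP := enum_valP a.
  have [i ia] := block_inh _ aP.
  by exists i; rewrite /idx -(blockE _ _ aP ia) enum_valK_in.
pose M : 'M[R]_(n, #|P|) := \matrix_(i, a) (a == idx i)%:R.
have ME (y : 'cV[R]_#|P|) i : (M *m y) i 0 = y (idx i) 0 :> R.
  rewrite mxE (bigD1 (idx i))//= mxE eqxx mul1r big1 ?addr0// => a /negPf ai.
  by rewrite mxE ai mul0r.
pose f : 'Hom('cV[R]_#|P|, 'cV[R]_n) := linfun (mulmx M).
pose s : 'Hom('cV[R]_n, 'cV[R]_1) := linfun (mulmx (const_mx 1)).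
have sE x : s x = (\sum_i x i 0)%:M.
  rewrite lfunE; apply/matrixP => i j; rewrite !ord1 !mxE eqxx mulr1n.
  by apply: eq_bigr => k _; rewrite mxE mul1r.
have mem_f x : x \in limg f <-> forall u v, same_block P u v -> x u 0 = x v 0.
  split=> [/memv_imgP[y _ ->] u v|xP].
    by rewrite -idxE => /eqP uv; rewrite lfunE /= !ME uv.
  have [r rE] := choice idx_surj.
  apply/memv_imgP; exists (\col_a x (r a) 0); first exact: memvf.
  apply/matrixP => i j; rewrite ord1 lfunE /= ME mxE.
  by apply: xP; rewrite -idxE rE.
have kerf : lker f = 0%VS.
  apply/eqP/lker0P => y z; rewrite !lfunE /= => /matrixP yz.
  apply/matrixP => a j; rewrite ord1; have [i <-] := idx_surj a.
  by have := yz i 0; rewrite !ME.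
have dimf : \dim (limg f) = #|P|.
  by rewrite limg_dim_eq ?kerf ?capv0// dimvf /dim/= muln1.
have lin_spanE : lin_span E = (limg f :&: lker s)%VS.
  apply/vspaceP => x; rewrite memv_cap memv_ker sE.
  apply/idP/andP => [/mem_span_eigenspace/eigenspace_blocks[xP ->]|[/mem_f xP
    /eqP x0]].
    by split; [exact/mem_f|rewrite raddf0].
  apply/mem_span_eigenspace/eigenspace_blocks; split=> //.
  by have /matrixP/(_ 0 0) := x0; rewrite !mxE mulr1n.
have dims : \dim (s @: limg f) = 1%N.
  apply/eqP; rewrite eqn_leq; apply/andP; split.
    by apply: leq_trans (dimvS (subvf _)) _; rewrite dimvf /dim/= muln1.
  rewrite lt0n dimv_eq0; apply/negP => /eqP s0.
  have : s (const_mx 1) \in (s @: limg f)%VS.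
    by apply: memv_img; apply/mem_f => u v; rewrite !mxE.
  rewrite s0 memv0 sE => /eqP/matrixP/(_ 0 0); rewrite !mxE mulr1n.
  under eq_bigr do rewrite mxE.
  rewrite sumr_const card_ord => /eqP; rewrite pnatr_eq0 => /eqP n0.
  by case: (u0) => m; rewrite n0.
have := limg_ker_dim s (limg f); rewrite dims dimf => <-.
by rewrite /dim_linspan lin_spanE addnK.
Qed.

End CoDisconnected.

(* Arcs follow x between blocks of different values, an arbitrary ranking of
   the blocks when the values agree, and O0 inside blocks. *)
Lemma codisconnected_cone_cover (R : realType) (n : nat) (G : sgraph 'I_n)
    (O0 : {set 'I_n * 'I_n}) (x : 'cV[R]_n) :
  ~~ graph_connected (complement_graph G) ->
  transitive_orientation G O0 ->
  (forall u v, same_block (canonical_partition G) u v -> x u 0 = x v 0) ->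
  exists O, transitive_orientation G O /\ cone O x.
Proof.
move=> disc /transitive_orientationP[OG GO tr] xP.
pose r i : nat := enum_rank [set w | connect (complement_graph G) i w]%SET.
have r_block i j : r i = r j -> same_block (canonical_partition G) i j.
  move=> /ord_inj/enum_rank_inj/setP/(_ j); rewrite !inE connect0.
  by rewrite (same_block_connect disc).
have xr i j : r i = r j -> x i 0 = x j 0 by move=> /r_block/xP.
have r_adj i j : r i != r j -> G i j.
  move=> rij; apply: (adjacent_across disc); apply: contra rij.
  rewrite (same_block_connect disc) => ij; apply/eqP;
    congr (nat_of_ord (enum_rank _)).
  have cs : connect_sym (complement_graph G).
    by apply: sym_connect_sym; apply: adj_sym.
  by apply/setP => w; rewrite !inE; apply/idP/idP; apply: connect_trans;
    rewrite // cs.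
pose lt := [rel i j | G i j && ((x i 0 < x j 0) ||
  (x i 0 == x j 0) && ((r i < r j)%N || (r i == r j) && ((i, j) \in O0)))].
have lt_le i j : lt i j -> x i 0 <= x j 0.
  by move=> /andP[_ /orP[/ltW//|/andP[/eqP->]]].
have lt_eq i j : lt i j -> x i 0 = x j 0 ->
    (r i < r j)%N || (r i == r j) && ((i, j) \in O0).
  by move=> /andP[_ /orP[|/andP[]//]] xij E; rewrite E ltxx in xij.
exists [set p | lt p.1 p.2]%SET; split; last by move=> i j;
  rewrite inE => /lt_le.
apply: (@transitive_orientation_rel _ G lt) => [i|j i k ij jk|i j].
- by rewrite /= adj_irr.
(* If the outer vertices share a block, both values and ranks are squeezed, so the middle vertex is
   in that block too and transitivity of [O0] decides. *)
- have [rik|rik] := eqVneq (r i) (r k).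
    have xij : x i 0 = x j 0.
      by apply/eqP; rewrite eq_le (lt_le _ _ ij) (xr _ _ rik) (lt_le _ _ jk).
    have xjk : x j 0 = x k 0 by rewrite -xij (xr _ _ rik).
    have := lt_eq _ _ ij xij; have := lt_eq _ _ jk xjk; rewrite rik.
    case: (ltngtP (r j) (r k)) => //= rjk jkO ikO.
    have ik : (i, k) \in O0 by apply: tr ikO jkO.
    by rewrite /= (OG _ _ ik) xij xjk eqxx rik eqxx ik !orbT.
  rewrite /= (r_adj _ _ rik) /=; case: ltP => //= xki.
  have xij : x i 0 = x j 0.
    by apply/eqP; rewrite eq_le (lt_le _ _ ij) (le_trans (lt_le _ _ jk)).
  have xjk : x j 0 = x k 0.
    by apply/eqP; rewrite eq_le (lt_le _ _ jk) -xij.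
  rewrite xij xjk eqxx /=.
  have := lt_eq _ _ ij xij; have := lt_eq _ _ jk xjk.
  case: (ltngtP (r i) (r k)) rik => //= rik _.
  by case: (ltngtP (r j) (r k)) => //= rjk; case: (ltngtP (r i) (r j)) =>
    //= rij _ _; move: rik rjk rij; lia.
- have [Gij|Gij] := boolP (G i j); last by rewrite /= (adj_sym G j) (negPf Gij).
  rewrite /= (adj_sym G j) Gij /=; case: (ltgtP (x i 0) (x j 0)) => //= xij.
  case: (ltngtP (r i) (r j)) => //= rij.
  by have := GO _ _ Gij; case: ((i, j) \in O0).
Qed.

(** * The top eigenspace when the complement is connected *)

Section CoConnected.
Variables (R : realType) (n : nat) (G : sgraph 'I_n) (lam : R).
Hypotheses (conG : graph_connected G)
  (conc : graph_connected (complement_graph G))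
  (lamP : largest_eigenvalue (laplacian R G) lam).
Implicit Types (x y : 'cV[R]_n) (A : {set 'I_n}).
Local Notation L := (laplacian R G).
Local Notation E := (col_eigenspace L lam).
Local Notation P := (canonical_partition G).
Local Notation coG := (complement_graph G).

Lemma module_nbhd A i k : is_module G A -> i \in A -> k \notin A ->
  (k \in nbhd G A) = G i k.
Proof.
move=> /is_moduleP mA iA kA; rewrite inE kA; apply/existsP/idP => /=.
  by move=> [i' /andP[i'A]]; rewrite (mA i' i k).
by move=> ik; exists i; rewrite iA.
Qed.

Lemma nbhd_notin A k : k \in nbhd G A -> k \notin A.
Proof. by rewrite inE => /andP[]. Qed.

(* The join of A with its neighbourhood has the Laplacian eigenvalue
   |A| + |N(A)|, and some edge leaves this join since neither G nor its
   complement is disconnected. *)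
Lemma module_eigenvalue_gap A : is_module G A -> A != finset.set0 ->
  A != [set: 'I_n]%SET ->
  (#|A| + #|nbhd G A|)%:R < lam.
Proof.
move=> mA /set0Pn[i0 i0A] AT; pose N := nbhd G A.
have NA k : k \in N -> k \notin A by exact: nbhd_notin.
have notin (C : {set 'I_n}) : C != [set: 'I_n]%SET -> exists t, t \notin C.
  move=> CT; apply/existsP; apply: contra_neqT CT => /existsPn CT.
  by apply/setP => t; rewrite inE; apply/negPn/CT.
have [t tA] := notin _ AT.
have N0 : exists k, k \in N.
  have [a [b [aA bA ab]]] := connected_cut conG i0A tA.
  by exists b; rewrite (module_nbhd mA aA bA).
have ANT : A :|: N != [set: 'I_n]%SET.
  apply/negP => /eqP AN.
  have [a [b [aA bA /andP[_ ab]]]] := connected_cut conc i0A tA.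
  have : b \in A :|: N by rewrite AN inE.
  by rewrite inE (negPf bA) /= (module_nbhd mA aA bA) (negPf ab).
have [s sAN] := notin _ ANT.
have [u [v [uN vA vN uv]]] : exists u v, [/\ u \in N, v \notin A,
  v \notin N & G u v].
  have i0AN : i0 \in A :|: N by rewrite finset.in_setU i0A.
  have [u [v [+ + uv]]] := connected_cut conG i0AN sAN.
  rewrite !finset.in_setU negb_or => /orP[uA|uN] /andP[vA vN];
    last by exists u, v.
  by move: vN; rewrite /N (module_nbhd mA uA vA) uv.
pose a : R := #|A|%:R; pose d : R := #|N|%:R.
have a0 : 0 < a by rewrite ltr0n; apply/card_gt0P; exists i0.
have d0 : 0 < d by rewrite ltr0n; apply/card_gt0P.
(* The top eigenvector of the complete bipartite graph between [A] and [N]. *)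
pose z : 'cV[R]_n := \col_i (d * (i \in A)%:R - a * (i \in N)%:R).
have zz : dot z z = a * d * (a + d).
  transitivity (\sum_i (d ^+ 2 * (i \in A)%:R + a ^+ 2 * (i \in N)%:R)).
    apply: eq_bigr => i _; rewrite !mxE.
    have [/NA /negPf->|_] := boolP (i \in N); first by rewrite /=; ring.
    by case: (i \in A) => /=; ring.
  by rewrite big_split/= -!mulr_sumr !sum_indicator -/a -/d; ring.
(* Each edge between [A] and [N] contributes [(a + d) ^+ 2] in both directions. The surplus [a ^+ 2]
   comes from one direction of the edge [u v], across which [z] goes from [- a] to 0; it makes the
   gap strict. *)
have zLz : 2 * (a * d * (a + d) ^+ 2) + a ^+ 2 <= 2 * dot z (L *m z).
  rewrite laplacian_dot.
  have -> : 2 * (a * d * (a + d) ^+ 2) + a ^+ 2 =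
      \sum_i \sum_k ((a + d) ^+ 2 * ((i \in A)%:R * (k \in N)%:R + (i \in N)%:R
        * (k \in A)%:R)
        + a ^+ 2 * ((i == u)%:R * (k == v)%:R)).
    have one w : \sum_i (i == w)%:R = 1 :> R.
      by rewrite (bigD1 w)//= eqxx big1 ?addr0// => i /negPf->.
    under eq_bigr do rewrite big_split/= -!mulr_sumr big_split/= -!mulr_sumr
      one !sum_indicator.
    rewrite big_split/= -!mulr_sumr -!mulr_suml one big_split/= -!mulr_suml
      !sum_indicator.
    by rewrite -/a -/d; ring.
  apply: ler_sum => i _; rewrite [leRHS]big_mkcond; apply: ler_sum => k _.
  have sq0 (b : bool) (c : R) : 0 <= (if b then c * c else 0).
    by case: b => //; rewrite -expr2 sqr_ge0.
  have [/andP[/eqP-> /eqP->]|nuv] := boolP ((i == u) && (k == v)).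
    by rewrite !eqxx uv (negPf vN) (negPf vA) !mxE (negPf vN) (negPf vA) uN
      (negPf (NA _ uN)) /=; lra.
  have -> : (i == u)%:R * (k == v)%:R = 0 :> R.
    by move: nuv; case: (i == u) => //=; [move=> /negPf->;
      rewrite mulr0|rewrite mul0r].
  rewrite mulr0 addr0.
  have [iA|iA] := boolP (i \in A); have [kN|kN] := boolP (k \in N); rewrite /=.
  - rewrite -(module_nbhd mA iA (NA _ kN)) kN !mxE iA kN (negPf (NA _ kN)).
    have -> : i \in N = false by apply: contraTF iA; exact: NA.
    by rewrite /=; lra.
  - have -> : i \in N = false by apply: contraTF iA; exact: NA.
    by rewrite mulr0 mul0r addr0 mulr0.
  - have -> : k \in A = false by apply: contraTF kN => kA; apply: contraL kA;
      exact: NA.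
    by rewrite mul0r mulr0 addr0 mulr0.
  - rewrite mul0r add0r; have [kA|kA] := boolP (k \in A);
      last by rewrite mulr0 mulr0.
    have [iN|iN] := boolP (i \in N); last by rewrite mul0r mulr0.
    rewrite adj_sym -(module_nbhd mA kA iA) iN !mxE kA iN (negPf iA) (negPf kN).
    by rewrite /=; lra.
have := rayleigh_le (laplacian_sym R G) lamP z; rewrite zz => ray.
rewrite natrD -/a -/d -subr_gt0.
have add_gt0 : 0 < a + d by lra.
have pos : 0 < 2 * (a * d * (a + d)) by rewrite !mulr_gt0.
rewrite -(pmulr_rgt0 _ pos).
have aa : 0 < a ^+ 2 by rewrite exprn_gt0.
suff : a ^+ 2 <= 2 * (a * d * (a + d)) * (lam - (a + d)) by apply: lt_le_trans.
have -> : 2 * (a * d * (a + d)) * (lam - (a + d)) =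
  2 * (lam * (a * d * (a + d))) - 2 * (a * d * (a + d) ^+ 2) by ring.
by move: zLz ray; lra.
Qed.

Lemma top_eigenvalue_gt0 : (1 < n)%N -> 0 < lam.
Proof.
move=> n1; pose i := Ordinal (ltnW n1); pose j := Ordinal n1.
apply: le_lt_trans (@module_eigenvalue_gap [set i]%SET _ _ _).
- by rewrite ler0n.
- by apply/is_moduleP => a b k; rewrite !inE => /eqP-> /eqP->.
- by apply/set0Pn; exists i; rewrite inE.
- by apply/negP => /eqP/setP/(_ j); rewrite !inE.
Qed.

(* The deviation y of x from its mean on A is a test vector supported on A:
   its Rayleigh quotient is lam, but at most |A| + |N(A)|. *)
Lemma eigenvector_module_const A x i j : E x -> is_module G A ->
  A != [set: 'I_n]%SET -> i \in A -> j \in A -> x i 0 = x j 0.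
Proof.
move=> Ex mA AT iA jA; pose N := nbhd G A.
have NA k : k \in N -> k \notin A by exact: nbhd_notin.
have A0 : A != finset.set0 by apply/set0Pn; exists i.
have gap := module_eigenvalue_gap mA A0 AT.
pose a : R := #|A|%:R; pose d : R := #|N|%:R.
have a0 : 0 < a by rewrite ltr0n; apply/card_gt0P; exists i.
pose m := (\sum_(k in A) x k 0) / a.
pose y : 'cV[R]_n := \col_k (if k \in A then x k 0 - m else 0).
have yA k : k \notin A -> y k 0 = 0 by rewrite mxE => /negPf->.
have y0 : \sum_k y k 0 = 0.
  under eq_bigr do rewrite mxE.
  rewrite -big_mkcond sumrB sumr_const -[m *+ _]mulr_natl -/a /m.
  by rewrite mulrC divfK ?subrr// gt_eqF.
suff yy : y = 0.
  have ym k : k \in A -> x k 0 = m.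
    move=> kA; have /matrixP/(_ k 0) := yy; rewrite !mxE kA.
    by move=> /eqP; rewrite subr_eq0 => /eqP.
  by rewrite !ym.
have yx : dot y x = dot y y.
  apply/eqP; rewrite -subr_eq0 -dotBr /dot.
  rewrite (eq_bigr (fun k => y k 0 * m)); first by rewrite -mulr_suml y0 mul0r.
  move=> k _; have [kA|kA] := boolP (k \in A); last by rewrite yA// !mul0r.
  by rewrite !mxE kA; congr (_ * _); ring.
(* The vector [x - y] is constant on the module [A], hence so is its image under [L], and [y] is a
   zero-sum vector supported on [A]. *)
have yLw : dot y (L *m (x - y)) = 0.
  have wA k : k \in A -> (x - y) k 0 = m by move=> kA; rewrite !mxE kA; ring.
  rewrite /dot (eq_bigr (fun k => y k 0 * (L *m (x - y)) i 0)).
    by rewrite -mulr_suml y0 mul0r.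
  move=> k _; have [kA|kA] := boolP (k \in A); last by rewrite yA// !mul0r.
  congr (_ * _); rewrite !laplacian_edge_diff; apply: eq_bigr => l _.
  rewrite /edge_diff (wA k)// (wA i)//; have [lA|lA] := boolP (l \in A).
    by rewrite (wA l)// subrr !if_same.
  by have /is_moduleP mA' := mA; rewrite (mA' k i l).
have yLy : dot y (L *m y) = lam * dot y y.
  have : dot y (L *m x) = lam * dot y y by rewrite Ex dotZr yx.
  by rewrite -{1}[x](subrK y) mulmxDr dotDr yLw add0r.
(* Completing [A] to a clique can only increase the form. For the clique joined to [N] the value is
   exact, because the mixed terms [y k 0 * y l 0] sum to zero. *)
have bound : 2 * dot y (L *m y) <= 2 * ((a + d) * dot y y).
  rewrite laplacian_dot.
  have -> : 2 * ((a + d) * dot y y) = \sum_k \sum_l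
      (y k 0 ^+ 2 * ((l \in A)%:R + (l \in N)%:R) +
       ((k \in A)%:R + (k \in N)%:R) * y l 0 ^+ 2 - 2 * y k 0 * y l 0).
    have sq : \sum_k y k 0 ^+ 2 = dot y y by apply: eq_bigr => k _;
      rewrite expr2.
    under eq_bigr do rewrite sumrB big_split/= -!mulr_sumr big_split/=
      !sum_indicator y0 mulr0 subr0 sq.
    rewrite big_split/= -!mulr_suml big_split/= !sum_indicator sq -/a -/d.
    by ring.
  apply: ler_sum => k _; rewrite [leLHS]big_mkcond; apply: ler_sum => l _.
  have [kA|kA] := boolP (k \in A); have [lA|lA] := boolP (l \in A); rewrite /=.
  - have /negPf -> : k \notin N by apply: contraL kA; exact: NA.
    have /negPf -> : l \notin N by apply: contraL lA; exact: NA.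
    have := sqr_ge0 (y k 0 - y l 0); case: (G k l) => /=; rewrite expr2; nra.
  - have /negPf -> : k \notin N by apply: contraL kA; exact: NA.
    rewrite (module_nbhd mA kA lA) (yA l lA); case: (G k l) => /=; nra.
  - have /negPf -> : l \notin N by apply: contraL lA; exact: NA.
    rewrite (module_nbhd mA lA kA) (adj_sym G k) (yA k kA); case: (G l k) => /=;
      nra.
  - by rewrite (yA k kA) (yA l lA); case: (G k l); rewrite /=; nra.
apply/eqP; rewrite -dot_eq0 eq_le dot_ge0 andbT.
move: gap; rewrite natrD -/a -/d -/N => gap.
have : (lam - (a + d)) * dot y y <= 0 by move: bound; rewrite yLy; nra.
by rewrite pmulr_rle0// subr_gt0.
Qed.

Lemma proper_module_same_block A i j : is_module G A -> A != [set: 'I_n]%SET ->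
  i \in A -> j \in A -> same_block P i j.
Proof.
move=> mA AT iA jA.
have [|B maxB /fintype.subsetP AB] := @maxset_exists _ (proper_module G) A;
  first exact/andP.
apply/same_blockP; exists B; split; try exact: AB.
by rewrite /canonical_partition conc inE.
Qed.

(** Adjacent vertices of equal value lie in one component of a fiber, which is a module. A proper
    module sits inside a block; otherwise [x] is constant, is killed by [L], and must vanish because
    [lam] is positive. *)
Lemma cone_eigenvector_separated O x i j : (1 < n)%N ->
  transitive_orientation G O -> cone O x -> E x -> x != 0 ->
  copartition G P i j -> x i 0 != x j 0.
Proof.
move=> n1 tO cx Ex x0 /andP[Gij nsb]; apply: contraNneq nsb => xij.
pose xi := [set k | x k 0 == x i 0]%SET.
have fxi : fiber x xi by exists (x i 0) => k; rewrite inE; split=> /eqP.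
have [Q [[/and3P[/eqP covQ _ _] dQ] mQ]] :=
  fiber_modules tO (orientable_comparability_graph tO) cx Ex fxi.
have inQ k : k \in xi -> exists2 B, B \in Q & k \in B.
  by rewrite -covQ => /bigcupP[B BQ kB]; exists B.
have [A AQ iA] : exists2 B, B \in Q & i \in B by apply: inQ; rewrite inE.
have [B BQ jB] : exists2 B, B \in Q & j \in B by apply: inQ; rewrite inE xij.
have AB : A = B.
  apply/eqP; apply: contraTT (Gij) => AB; exact: dQ AQ BQ AB _ _ iA jB.
subst B; have [mA _ _] := mQ _ AQ.
apply: proper_module_same_block mA _ iA jB; apply/eqP => AT.
have xc k : x k 0 = x i 0.
  have : k \in xi by rewrite -covQ; apply/bigcupP; exists A; rewrite // AT inE.
  by rewrite inE => /eqP.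
case/eqP: x0; apply/matrixP => k l; rewrite ord1 mxE.
have /matrixP/(_ k 0) := Ex; rewrite laplacianE mxE big1.
  move/esym/eqP; rewrite mulf_eq0 gt_eqF ?top_eigenvalue_gt0// => /eqP //.
by move=> w _; rewrite !xc subrr.
Qed.

Lemma cone_eigenvector_ex O : transitive_orientation G O ->
  exists x, [/\ cone O x, E x & x != 0].
Proof.
move=> tO; have [v Lv v0] := eigenvector_ex (laplacian_sym R G) lamP.
have [a [b [ca Ea cb Eb vE]]] := cone_eigenvector_diff tO lamP Lv.
have [a0|] := eqVneq a 0; last by exists a.
by exists b; split=> //; apply: contraNneq v0 => b0; rewrite vE a0 b0 subrr.
Qed.

(* Subtract from y the largest multiple of x that keeps it in the cone: the
   difference lies in the cone but is not separated. *)
Lemma top_eigenspace_line O x y : (1 < n)%N ->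
  transitive_orientation G O -> cone O x -> E x -> x != 0 -> E y ->
  exists t, y = t *: x.
Proof.
move=> n1 tO cx Ex x0 Ey; have /transitive_orientationP[OG GO _] := tO.
have [u [v uv]] : exists u v, copartition G P u v.
  by apply: copartition_edge; rewrite ?card_ord.
pose cross p := (p \in O) && ~~ same_block P p.1 p.2.
have [p0 p0P] : exists p, cross p.
  have /andP[Guv nsb] := uv.
  have := GO _ _ Guv; case uvO : ((u, v) \in O).
    by exists (u, v); rewrite /cross uvO.
  by move=> /= vuO; exists (v, u); rewrite /cross vuO same_block_sym.
have x_lt p : cross p -> 0 < x p.2 0 - x p.1 0.
  case: p => i j /andP[/= ij nsb]; rewrite subr_gt0 lt_neqAle (cx _ _ ij) andbT.
  by apply: (cone_eigenvector_separated n1 tO cx Ex x0); rewrite /= (OG _ _ ij).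
pose ratio p := (y p.2 0 - y p.1 0) / (x p.2 0 - x p.1 0).
case: (arg_minP ratio p0P) => p pP pmin.
pose z := y - ratio p *: x.
have Ez : E z by rewrite /col_eigenspace/= mulmxBr -scalemxAr Ex Ey scalerBr
  !scalerA mulrC.
exists (ratio p); apply/eqP; rewrite -subr_eq0 -/z; apply: contraT => z0.
(* Arcs inside a block impose nothing, since eigenvectors are constant there; the minimum over
   crossing arcs handles the rest. *)
have cz : cone O z.
  move=> i j ij; have [sb|nsb] := boolP (same_block P i j).
    have /same_blockP[A [AP iA jA]] := sb.
    by rewrite (eigenvector_module_const Ez (block_module AP) (block_proper
      conG AP) iA jA).
  have ijP : cross (i, j) by rewrite /cross ij.
  have := pmin _ ijP; rewrite {2}/ratio ler_pdivlMr ?x_lt//= !mxE; lra.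
have /andP[pO pnsb] := pP.
have : copartition G P p.1 p.2 by rewrite /= OG//; case: (p) pO.
move=> /(cone_eigenvector_separated n1 tO cz Ez z0)/eqP[].
have : ratio p * (x p.2 0 - x p.1 0) = y p.2 0 - y p.1 0.
  by rewrite divfK// gt_eqF// x_lt.
by rewrite !mxE; lra.
Qed.

Lemma dim_eigenspace_coconnected O : transitive_orientation G O ->
  dim_linspan E = 1%N.
Proof.
move=> tO; have [x [cx Ex x0]] := cone_eigenvector_ex tO.
apply/eqP; rewrite eqn_leq; apply/andP; split; last first.
  rewrite lt0n dimv_eq0; apply: contraNneq x0 => sp0.
  by move/mem_span_eigenspace: Ex; rewrite sp0 memv0.
have [n1|n1] := ltnP 1 n; last first.
  by apply: leq_trans (dimvS (subvf _)) _; rewrite dimvf /dim/= muln1.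
have [_ minE] := lin_spanP E.
have := dimvS (minE <[x]>%VS _); rewrite dim_vline x0; apply => y Ey.
by have [t ->] := top_eigenspace_line n1 tO cx Ex x0 Ey;
  rewrite memvZ ?memv_line.
Qed.

Lemma coconnected_cone_cover O x : transitive_orientation G O -> E x ->
  exists O', transitive_orientation G O' /\ cone O' x.
Proof.
move=> tO Ex; have [y [cy Ey y0]] := cone_eigenvector_ex tO.
have [n1|n1] := ltnP 1 n; last first.
  exists O; split=> // i j _; suff -> : i = j by [].
  by apply: ord_inj; move: (ltn_ord i) (ltn_ord j) n1; lia.
have [t ->] := top_eigenspace_line n1 tO cy Ey y0 Ex.
have [t0|t0] := leP 0 t.
  by exists O; split=> // i j ij; rewrite !mxE ler_wpM2l//; apply: cy.
exists (reverse_orientation O); split; first exact: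
  reverse_transitive_orientation.
by move=> i j; rewrite inE/= => ji; rewrite !mxE ler_wnM2l//;
  [exact: ltW|apply: cy].
Qed.

End CoConnected.

(** * Generic top eigenvectors and the orientations they induce *)

Section TopEigenspace.
Variables (R : realType) (n : nat) (G : sgraph 'I_n) (lam : R).
Hypotheses (conG : graph_connected G) (compG : comparability_graph G)
  (lamP : largest_eigenvalue (laplacian R G) lam).
Implicit Types (x y : 'cV[R]_n) (A : {set 'I_n}) (O : {set 'I_n * 'I_n}).
Local Notation L := (laplacian R G).
Local Notation E := (col_eigenspace L lam).
Local Notation P := (canonical_partition G).
Local Notation GP := (copartition G P).

Lemma eigenspaceD x y : E x -> E y -> E (x + y).
Proof. by rewrite /col_eigenspace/= mulmxDr scalerDr => -> ->. Qed.

Lemma eigenspace_block_const x i j : E x -> same_block P i j -> x i 0 = x j 0.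
Proof.
move=> Ex; have [conc|disc] := boolP (graph_connected (complement_graph G)).
  move=> /same_blockP[A [AP iA jA]].
  exact: (eigenvector_module_const conG conc lamP Ex (block_module AP)
    (block_proper conG AP)).
by have [+ _] := top_eigenvector_blocks conG disc lamP Ex; apply.
Qed.

Lemma eigenspace_cone_cover x : E x ->
  exists O, transitive_orientation G O /\ cone O x.
Proof.
move=> Ex; have [ O tO] := comparability_graph_orientable compG.
have [conc|disc] := boolP (graph_connected (complement_graph G)).
  exact: (coconnected_cone_cover conG conc lamP tO Ex).
apply: codisconnected_cone_cover disc tO _ => u v.
exact: eigenspace_block_const.
Qed.

Lemma copartition_edge_separated i j : GP i j ->
  exists x, E x /\ x i 0 != x j 0.
Proof.
move=> ij; have [conc|disc] := boolP (graph_connected (complement_graph G)).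
  have [ O tO] := comparability_graph_orientable compG.
  have [x [cx Ex x0]] := cone_eigenvector_ex lamP tO.
  exists x; split=> //.
  apply: (cone_eigenvector_separated conG conc lamP _ tO cx Ex x0 ij).
  have /andP[Gij _] := ij.
  have : i != j by apply: contraTneq Gij => ->; rewrite adj_irr.
  by rewrite -(inj_eq val_inj) /=; move: (ltn_ord i) (ltn_ord j); lia.
have /andP[_ nsb] := ij; exists (block_difference R G i j); split.
  exact: (block_difference_eigenspace conG disc lamP).
have /andP[lt0 gt0] := block_difference_gt0 R disc nsb.
by rewrite gt_eqF// (lt_trans lt0 gt0).
Qed.

(** For each crossing arc some eigenvector separates its ends; it is a difference of two
    eigenvectors in the cone, one of which must separate them as well. Summing over all arcs stays
    in the cone and keeps every strict inequality. *)
Lemma generic_cone_eigenvector O : transitive_orientation G O ->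
  exists x, [/\ cone O x, E x & forall i j, (i, j) \in O ->
    ~~ same_block P i j -> x i 0 < x j 0].
Proof.
move=> tO; have /transitive_orientationP[OG _ _] := tO.
have zero_cone : cone O (0 : 'cV[R]_n) by move=> i j _; rewrite !mxE.
have zeroE : E 0 by rewrite /col_eigenspace/= mulmx0 scaler0.
have sep p : exists y, [/\ cone O y, E y &
    p \in O -> ~~ same_block P p.1 p.2 -> y p.1 0 != y p.2 0].
  case: p => i j /=; have [/andP[ij nsb]|no] := boolP (((i,
    j) \in O) && ~~ same_block P i j); last first.
    by exists 0; split=> // ij nsb; rewrite ij nsb in no.
  have [|x [Ex xij]] := @copartition_edge_separated i j; first by rewrite /= OG.
  have [a [b [ca Ea cb Eb xE]]] := cone_eigenvector_diff tO lamP Ex.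
  have [aij|] := eqVneq (a i 0) (a j 0); last by exists a.
  exists b; split=> // _ _; apply: contraNneq xij => bij.
  by rewrite xE !mxE aij bij.
have [F FP] := choice sep.
exists (\sum_p F p); split.
- by move=> i j ij; rewrite !summxE; apply: ler_sum => p _;
    have [+ _ _] := FP p; apply.
- by elim/big_ind: _ => //[y z|p _]; [exact: eigenspaceD|have [] := FP p].
- move=> i j ij nsb; rewrite !summxE (bigD1 (i, j))//= [ltRHS](bigD1 (i, j))//=.
  apply: ltr_leD.
    have [cF _ /(_ ij nsb) Fij] := FP (i, j).
    by rewrite lt_neqAle Fij cF.
  by apply: ler_sum => p _; have [+ _ _] := FP p; apply.
Qed.

(** The eigenspace minus finitely many subspaces, each of them proper by
    [copartition_edge_separated]. *)
Definition generic x := E x /\ forall i j, GP i j -> x i 0 != x j 0.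

(** Choose a transitive orientation of [G] whose cone contains [x]; on crossing edges it agrees with
    the order of the values. A composite of two such arcs strictly increases [x], so it cannot end
    in the block where it began. *)
Lemma generic_transitive_orientation x : generic x ->
  transitive_orientation GP (induced_orientation GP x).
Proof.
move=> [Ex sep]; have [ O [tO cx]] := eigenspace_cone_cover Ex.
have /transitive_orientationP[OG GO tr] := tO.
have arcO i j : GP i j -> x i 0 < x j 0 -> (i, j) \in O.
  move=> /andP[Gij _] xij; have := GO _ _ Gij; case: ((i, j) \in O) => //= ji.
  by have := cx _ _ ji; rewrite leNgt xij.
pose lt := [rel i j | GP i j && (x i 0 < x j 0)].
apply: (@transitive_orientation_rel _ GP lt) => [i|j i k|i j].
- by rewrite /= ltxx andbF.
- move=> /andP[ij xij] /andP[jk xjk]; have xik := lt_trans xij xjk.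
  have ikO : (i, k) \in O by apply: tr (arcO _ _ ij xij) (arcO _ _ jk xjk).
  apply/andP; split=> //; rewrite /= (OG _ _ ikO) /=.
  by apply: contraL xik => /(eigenspace_block_const Ex)->; rewrite ltxx.
- change (GP i j = (GP i j && (x i 0 < x j 0)) || (GP j i && (x j 0 < x i 0))).
  rewrite (adj_sym GP j i).
  have [ij|] := boolP (GP i j); last by [].
  by have := sep _ _ ij; rewrite neq_lt.
Qed.

(** One generic eigenvector is constructed explicitly, so no measure on the sphere is required. *)
Lemma copartition_comparability : comparability_graph GP.
Proof.
have [ O tO] := comparability_graph_orientable compG.
have /transitive_orientationP[_ GO _] := tO.
have [x [cx Ex xlt]] := generic_cone_eigenvector tO.
apply: (@orientable_comparability_graph _ _ (induced_orientation GP x)).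
apply: generic_transitive_orientation; split=> // i j /andP[Gij nsb].
have := GO _ _ Gij; case ij : ((i, j) \in O); first by rewrite lt_eqF ?xlt.
by move=> /= ji; rewrite gt_eqF// xlt// same_block_sym.
Qed.

Lemma copartition_orientation_realized O' : transitive_orientation GP O' ->
  exists x, E x /\ forall i j, (i, j) \in O' -> x i 0 < x j 0.
Proof.
move=> tO'; have [ O tO] := comparability_graph_orientable compG.
have [x [cx Ex xlt]] := generic_cone_eigenvector (extend_transitive_orientation
  conG tO' tO).
have /transitive_orientationP[OG' _ _] := tO'.
exists x; split=> // i j ij; apply: xlt; first by rewrite inE ij.
by have /andP[] := OG' _ _ ij.
Qed.

Lemma induced_orientationE O' x : transitive_orientation GP O' ->
  induced_orientation GP x = O' <-> forall i j, (i, j) \in O' -> x i 0 < x j 0.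
Proof.
move=> /transitive_orientationP[OG' GO' _]; split=> [<- i j|xlt].
  by rewrite inE => /andP[].
apply/setP => -[i j]; rewrite inE /=; apply/andP/idP => [[ij xij]|ij].
  have := GO' _ _ ij; case: ((i, j) \in O') => //= /xlt.
  by rewrite ltNge ltW.
by split; [exact: OG' ij|exact: xlt].
Qed.

Lemma fiber_nonempty x A (i : 'I_n) : (forall j k, j \in A -> k \in A -> x j 0 =
  x k 0) ->
  exists xi : {set 'I_n}, [/\ fiber x xi, A \subset xi & xi != finset.set0].
Proof.
move=> Ac; have [->|/set0Pn[j jA]] := eqVneq A finset.set0.
  exists [set k | x k 0 == x i 0]%SET; split; rewrite ?finset.sub0set//.
    by exists (x i 0) => k; rewrite inE; split=> /eqP.
  by apply/set0Pn; exists i; rewrite inE.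
exists [set k | x k 0 == x j 0]%SET; split.
- by exists (x j 0) => k; rewrite inE; split=> /eqP.
- by apply/fintype.subsetP => k kA; rewrite inE (Ac k j).
- by apply/set0Pn; exists j; rewrite inE.
Qed.

(** A fiber may belong to a value that is not attained. This serves the one-vertex graph, where
    [set0] counts as a block and still needs a fiber different from another one. *)
Lemma fiber0 x : fiber x finset.set0.
Proof.
exists (1 + \sum_i `|x i 0|) => i; rewrite inE; split=> // xi.
have : x i 0 <= \sum_i `|x i 0|.
  by rewrite (le_trans (ler_norm _))// (bigD1 i)//= lerDl sumr_ge0.
by rewrite xi; lra.
Qed.

Lemma eigenspace_block_fiber x A : E x -> A \in P ->
  exists xi : {set 'I_n}, [/\ fiber x xi, A \subset xi & xi != finset.set0].
Proof.
move=> Ex AP; have [n0 _] := andP conG.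
have [i _] := card_gt0P n0.
apply: fiber_nonempty i _ => j k jA kA.
by apply: eigenspace_block_const Ex _; apply/same_blockP; exists A.
Qed.

Lemma generic_adjacent_blocks x A A' : generic x -> A \in P -> A' \in P ->
  completely_adjacent G A A' ->
  exists xi xi', [/\ fiber x xi, fiber x xi', xi <> xi',
    A \subset xi & A' \subset xi'].
Proof.
move=> [Ex sep] AP A'P /andP[disj /'forall_in_'forall_in_idP adjA].
have [xi [fxi sA xi0]] := eigenspace_block_fiber Ex AP.
have [xi' [fxi' sA' xi'0]] := eigenspace_block_fiber Ex A'P.
have [A0|/set0Pn[i iA]] := eqVneq A finset.set0.
  exists finset.set0, xi'; split=> //; first exact: fiber0.
    by move=> E0; rewrite -E0 eqxx in xi'0.
  by rewrite A0 finset.sub0set.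
have [A0|/set0Pn[j jA']] := eqVneq A' finset.set0.
  exists xi, finset.set0; split=> //; first exact: fiber0.
    by move=> E0; rewrite E0 eqxx in xi0.
  by rewrite A0 finset.sub0set.
exists xi, xi'; split=> // xixi'.
have iP : i \in xi by exact: (fintype.subsetP sA).
have jP : j \in xi by rewrite xixi'; exact: (fintype.subsetP sA').
have : GP i j.
  rewrite /= adjA//=; apply/negP => /same_blockP[B [BP iB jB]].
  have AB := block_unique conG AP BP iA iB; have A'B :=
    block_unique conG A'P BP jA' jB.
  by have := disjointFr disj iA; rewrite A'B -AB iA.
move=> /sep/eqP[]; have [a aP] := fxi.
by rewrite (aP i).2// (aP j).2.
Qed.

(** Exactly two orientations means one and its reverse. A third one arises from an edge inside a
    block, which can be reversed independently of the crossing edges, or from three co-components,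
    which can be ordered in several ways. *)
Lemma two_orientations_generic x : (1 < n)%N -> generic x ->
  #|transitive_orientations G| = 2%N <->
  dim_linspan E = 1%N /\ (forall xi, fiber x xi -> independent G xi).
Proof.
move=> n1 gx; have [Ex sep] := gx.
have [u [v uv]] : exists u v, GP u v by apply: copartition_edge;
  rewrite ?card_ord.
have /andP[Guv nsb] := uv.
have [ O0 tO0] := comparability_graph_orientable compG.
split=> [card2|[dim1 indep]]; last first.
  have x0 : x != 0 by apply: contraTneq (sep _ _ uv) => ->; rewrite !mxE eqxx.
  have xG i j : G i j -> x i 0 != x j 0.
    move=> ij; apply/eqP => xij.
    have /indep/'forall_in_'forall_in_idP : fiber x [set k |
      x k 0 == x i 0]%SET.
      by exists (x i 0) => k; rewrite inE; split=> /eqP.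
    by move=> /(_ i _ j); rewrite !inE xij eqxx ij => /(_ isT isT).
  (* Here [x] separates all edges of [G], so it determines any orientation whose cone contains
     it. *)
  have xO O : transitive_orientation G O -> cone O x -> O =
    [set p | G p.1 p.2 && (x p.1 0 < x p.2 0)]%SET.
    move=> /transitive_orientationP[OG GO _] cx; apply/setP => -[i j];
      rewrite inE /=.
    apply/idP/andP => [ij|[ij xij]].
      by split; [exact: OG|rewrite lt_neqAle xG ?OG// cx].
    have := GO _ _ ij; case: ((i, j) \in O) => //= ji.
    by have := cx _ _ ji; rewrite leNgt xij.
  have cover O : transitive_orientation G O -> cone O x \/ cone
    (reverse_orientation O) x.
    move=> tO; have [y [cy Ey y0]] := cone_eigenvector_ex lamP tO.
    have /eqP lineE : (<[y]> == lin_span E)%VS.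
      rewrite eqEdim; apply/andP; split; first exact/mem_span_eigenspace.
      by rewrite [X in (X <= _)%N]dim1 dim_vline y0.
    have /vlineP[t ->] : x \in <[y]>%VS by rewrite lineE;
      apply/mem_span_eigenspace.
    have [t0|t0] := leP 0 t; [left=> i j ij|right=> i j].
      by rewrite !mxE ler_wpM2l//; apply: cy.
    by rewrite inE/= => ji; rewrite !mxE ler_wnM2l//; [exact: ltW|apply: cy].
  have [ O [tO cO]] : exists O, transitive_orientation G O /\ cone O x.
    exact: eigenspace_cone_cover.
  apply: (two_transitive_orientations Guv tO) => O' tO'.
  have [cO'|crO'] := cover _ tO'; first by left;
    rewrite (xO _ tO cO) (xO _ tO' cO').
  right; rewrite (xO _ tO cO) -(xO _ (reverse_transitive_orientation tO') crO').
  by apply/setP => -[i j]; rewrite !inE.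
have same_or_rev := @two_transitive_orientations_reverse _ G _ _ _ _ Guv card2.
split; last first.
  move=> xi [a xiP]; apply/'forall_in_'forall_in_idP => i ixi j jxi.
  apply/negP => Gij.
  have sij : same_block P i j.
    apply: contraT => nsij; have /sep : GP i j by rewrite /= Gij.
    by rewrite ((xiP i).2 ixi) ((xiP j).2 jxi) eqxx.
  (* Keep the crossing arcs given by [x] and orient the inside of blocks by [O0] or by its reverse.
     The results differ at [i j] and agree at [u v], so they are neither equal nor opposite. *)
  have tx := generic_transitive_orientation gx.
  have t1 := extend_transitive_orientation conG tx tO0.
  have t2 := extend_transitive_orientation conG tx
    (reverse_transitive_orientation tO0).
  have /transitive_orientationP[_ GO0 _] := tO0.
  have [/setP/(_ (i, j))|/setP] := same_or_rev _ _ t1 t2.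
    by have := GO0 _ _ Gij; rewrite !inE /= sij Gij /= ; case: (_ \in O0);
      case: (_ \in O0).
  have := sep _ _ uv; rewrite neq_lt => /orP[] xuv.
    move=> /(_ (u, v)); rewrite !inE /= Guv nsb xuv /= (same_block_sym G v u)
      (negPf nsb).
    by rewrite (ltNge (x v 0)) (ltW xuv) andbF.
  move=> /(_ (v, u)); rewrite !inE /= (adj_sym G v) Guv (same_block_sym G v u)
    nsb xuv /=.
  by rewrite (ltNge (x u 0)) (ltW xuv) (negPf nsb).
have [conc|disc] := boolP (graph_connected (complement_graph G)).
  exact: (dim_eigenspace_coconnected conG conc lamP tO0).
(* With three blocks, orientations realizing b < c < d and b < d < c are
   neither equal nor opposite. *)
have arc y O i j : transitive_orientation G O -> cone O y -> G i j ->
  y i 0 < y j 0 -> (i, j) \in O.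
  move=> /transitive_orientationP[_ GO _] cy /GO;
    case: ((i, j) \in O) => //= /cy.
  by rewrite leNgt => /negPf->.
have [w_ex|no_w] := boolP [exists w, ~~ same_block P u w && ~~ same_block P v
  w].
  have /existsP[w /andP[uw vw]] := w_ex.
  have Ed i j : E (block_difference R G i j) by exact:
    (block_difference_eigenspace conG disc lamP).
  have [ O1 [t1 c1]] := eigenspace_cone_cover (Ed v u).
  have [ O2 [t2 c2]] := eigenspace_cone_cover (Ed w u).
  have nvu : ~~ same_block P v u by rewrite same_block_sym.
  have nwu : ~~ same_block P w u by rewrite same_block_sym.
  have nwv : ~~ same_block P w v by rewrite same_block_sym.
  have Gvw := adjacent_across disc vw; have Guw := adjacent_across disc uw.
  have /andP[d1u d1v] := block_difference_gt0 R disc nvu.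
  have /andP[d2u d2w] := block_difference_gt0 R disc nwu.
  have d1w := block_difference_eq0 R vw uw.
  have d2v := block_difference_eq0 R nwv nsb.
  have u1 : (u, v) \in O1 by apply: arc t1 c1 Guv (lt_trans d1u d1v).
  have u2 : (u, v) \in O2 by apply: arc t2 c2 Guv _; rewrite d2v.
  have wv1 : (w, v) \in O1 by apply: arc t1 c1 _ _; rewrite ?d1w// adj_sym.
  have vw2 : (v, w) \in O2 by apply: arc t2 c2 Gvw _; rewrite d2v.
  have /transitive_orientationP[_ GO1 _] := t1.
  have [ O12|O12] := same_or_rev _ _ t1 t2.
    by have := GO1 _ _ Gvw; rewrite wv1 -O12 vw2.
  by have := GO1 _ _ Guv; move: u2; rewrite O12 inE /= u1 => ->.
(* No vertex avoids the blocks of both [u] and [v], so there are just two blocks. *)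
rewrite (dim_eigenspace_blocks conG disc lamP).
have -> : P = [set [set w | same_block P u w]; [set w | same_block P v w]]%SET.
  have PE : P = graph_components (complement_graph G) by rewrite
    /canonical_partition (negPf disc).
  have inP w : [set w' | same_block P w w']%SET \in P.
    rewrite {2}PE; apply/imsetP; exists w => //; apply/setP => w'.
    by rewrite !inE (same_block_connect disc).
  apply/setP => A; rewrite !inE; apply/idP/orP => [AP|[]/eqP->];
    [|exact: inP|exact: inP].
  have [i iA] : exists i, i \in A.
    by move: AP; rewrite {1}PE => /imsetP[i _ ->]; exists i;
      rewrite inE connect0.
  have : same_block P u i || same_block P v i.
    by move/existsPn: no_w => /(_ i); rewrite negb_and !negbK.
  have iP w : same_block P w i -> A = [set w' | same_block P w w']%SET.
    move=> wi; apply: (block_unique conG AP (inP w) iA).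
    by rewrite inE.
  by move=> /orP[]/iP/eqP; [left|right].
rewrite cards2 (_ : _ != _)//; apply: contra nsb => /eqP/setP/(_ v).
by rewrite !inE (same_block_refl disc).
Qed.

End TopEigenspace.

(** * The uniform measure on the sphere of a subspace *)

Lemma equimeasurable_null (d : measure_display) (T : measurableType d) (R :
  realType)
    (mu : probability T R) (m : \bar R) (A : nat -> set T) :
  (forall i, measurable (A i)) -> (forall i, mu (A i) = m) ->
  (forall i j, i != j -> mu.-negligible (A i `&` A j)) -> m = 0%E.
Proof.
move=> mA Am AI.
have m_ge0 : (0 <= m)%E by rewrite -(Am 0%N) measure_ge0.
have m_le1 : (m <= 1)%E by rewrite -(Am 0%N) probability_le1.
have mfin : m \is a fin_num by rewrite ge0_fin_numE//;
  apply: le_lt_trans m_le1 _; rewrite ltry.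
pose U N := \big[setU/set0]_(i < N) A i.
have mU N : measurable (U N) by exact: bigsetU_measurable.
have UN N : mu (U N) = (N%:R * fine m)%:E.
  elim: N => [|N IHN]; first by rewrite /U big_ord0 measure0 mul0r.
  have -> : U N.+1 = U N `|` A N by rewrite /U big_ord_recr.
  have muA : (mu (A N) < +oo)%E by rewrite Am (le_lt_trans m_le1)// ltry.
  have E : mu (U N `|` A N) = (mu (U N) + mu (A N) - mu (U N `&` A N))%E.
    exact: measureUfinr.
  have null : mu (U N `&` A N) = 0%E.
    apply/negligibleP; first exact: measurableI.
    rewrite /U big_distrl/= -(big_mkord xpredT (fun i =>
      A i `&` A N)) big_seq_cond.
    apply: negligible_bigsetU => k; rewrite andbT mem_index_iota => /andP[_ kN].
    by apply: AI; rewrite ltn_eqF.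
  by rewrite E null IHN Am sube0 -natr1 mulrDl mul1r EFinD fineK.
apply/eqP; rewrite eq_le m_ge0 andbT -(fineK mfin) lee_fin leNgt;
  apply/negP => m_gt0.
have : (mu (U (Num.truncn (fine m)^-1).+1) <= 1)%E by exact: probability_le1.
rewrite UN lee_fin leNgt -ltr_pdivrMr// mul1r => /negP[].
exact: truncnS_gt.
Qed.

Section Borel.
Variables (R : realType) (n : nat).
Local Notation B := (borel_cV R n).

Lemma open_borel (A : set 'cV[R]_n) : open A -> measurable (A : set B).
Proof. exact: sub_sigma_algebra. Qed.

Lemma closed_borel (A : set 'cV[R]_n) : closed A -> measurable (A : set B).
Proof.
move=> cA; rewrite -(setCK A); apply: measurableC; apply: open_borel.
exact: closed_openC.
Qed.

Lemma continuous_coord_sum (F : 'I_n -> R -> R) : (forall i,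
  continuous (F i)) ->
  continuous (fun x : 'cV[R]_n => \sum_i F i (x i 0)).
Proof.
move=> cF x; apply: cvg_big => [||i _]; first exact: add_continuous.
  exact: nbhs_filter.
by apply: continuous_comp; [exact: coord_continuous|exact: cF].
Qed.

(** A subspace is cut out by the coordinates of its projector minus the identity; written as
    coordinate sums these are visibly continuous. *)
Lemma vspace_borel (W : {vspace 'cV[R]_n}) : measurable ([set x |
  x \in W] : set B).
Proof.
have -> : [set x | x \in W] =
    \bigcap_(i in [set: 'I_n]) [set x : 'cV[R]_n |
      \sum_j (projv W (delta_mx j 0) - delta_mx j 0) i 0 * x j 0 = 0].
  have E x i : (projv W x - x) i 0 = \sum_j (projv W (delta_mx j 0) - delta_mx
    j 0) i 0 * x j 0.
    have xE : x = \sum_j x j 0 *: delta_mx j 0.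
      rewrite {1}[x]matrix_sum_delta; apply: eq_bigr => j _.
      by rewrite big_ord1.
    rewrite {1 2}xE linear_sum -sumrB summxE; apply: eq_bigr => j _.
    by rewrite linearZ -scalerBr mxE mulrC.
  apply/seteqP; split=> x /= => [xW i _|xW].
    by rewrite /= -E projv_id// subrr mxE.
  suff /eqP : projv W x - x = 0 by rewrite subr_eq0 => /eqP <-;
    exact: memv_proj.
  by apply/matrixP => i j; rewrite ord1 E mxE; exact: xW.
apply: fin_bigcap_measurable => // i _; apply: closed_borel.
apply: (@closed_comp _ _ (fun x : 'cV[R]_n => \sum_j (projv W (delta_mx j 0) -
  delta_mx j 0) i 0 * x j 0) [set 0]).
  move=> x _; apply: (@continuous_coord_sum (fun j r => _ * r)) => j r.
  by apply: cvgMl_tmp; exact: cvg_id.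
exact: closed_eq.
Qed.

Lemma dist_ball_open (y : 'cV[R]_n) (r : R) : open [set x |
  dot (x - y) (x - y) < r].
Proof.
apply: (@open_comp _ _ (fun x : 'cV[R]_n => dot (x - y) (x - y)) [set t |
  t < r]).
  move=> x _.
  have -> : (fun x : 'cV[R]_n => dot (x - y) (x - y)) = (fun x =>
    \sum_i (x i 0 - y i 0) * (x i 0 - y i 0)).
    by apply/funext => z; apply: eq_bigr => i _; rewrite !mxE.
  apply: (@continuous_coord_sum (fun i t => (t - y i 0) * (t - y i 0))) => i t.
  by apply: cvgM; apply: cvgB; [exact: cvg_id|exact: cvg_cst|exact:
    cvg_id|exact: cvg_cst].
exact: open_lt.
Qed.

Definition strictly_ordered (O : {set 'I_n * 'I_n}) : set 'cV[R]_n :=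
  [set x | forall i j, (i, j) \in O -> x i 0 < x j 0].

Lemma strictly_ordered_borel (O : {set 'I_n * 'I_n}) :
  measurable (strictly_ordered O : set B).
Proof.
have -> : strictly_ordered O =
    \bigcap_(p in [set` O]) [set x : 'cV[R]_n | x p.1 0 < x p.2 0].
  apply/seteqP; split=> x /= h; first by move=> [i j] /= ij; exact: h.
  by move=> i j ij; exact: (h (i, j)).
apply: fin_bigcap_measurable => [|p _]; first exact: finite_finset.
apply: open_borel; rewrite (_ : [set _ | _] =
  (fun x : 'cV[R]_n => x p.2 0 - x p.1 0) @^-1` [set t | 0 < t]); last first.
  by apply/seteqP; split=> x /=; rewrite subr_gt0.
apply: open_comp; last exact: open_gt.
move=> x _; apply: cvgB; [exact: nbhs_filter|exact: coord_continuous|exact: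
  coord_continuous].
Qed.

Lemma coord_dist_lt (x y : 'cV[R]_n) (r : R) i : 0 < r ->
  dot (x - y) (x - y) < r ^+ 2 -> `|x i 0 - y i 0| < r.
Proof.
move=> r0 xy; have : (x i 0 - y i 0) ^+ 2 < r ^+ 2.
  apply: le_lt_trans xy; rewrite /dot (bigD1 i)//= !mxE -expr2 lerDl.
  by apply: sumr_ge0 => j _; rewrite -expr2 sqr_ge0.
by rewrite ltr_norml => h; apply/andP; split; nra.
Qed.

Lemma strictly_ordered_ball (O : {set 'I_n * 'I_n}) y : strictly_ordered O y ->
  exists2 r : R, 0 < r & forall x, dot (x - y) (x - y) < r ^+ 2 ->
    strictly_ordered O x.
Proof.
move=> yO; pose gap p := y p.2 0 - y p.1 0.
have gap_gt0 p : p \in O -> 0 < gap p by case: p => i j /yO; rewrite subr_gt0.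
(* The inverse of [S] is a positive lower bound for all gaps, and the summand 1 keeps it meaningful
   when [O] is empty. *)
pose S := 1 + \sum_(p in O) (gap p)^-1.
have S_gt0 : 0 < S.
  by rewrite ltr_pwDl// sumr_ge0// => p /gap_gt0/ltW; rewrite invr_ge0.
have S_gap p : p \in O -> S^-1 <= gap p.
  move=> pO; rewrite -[leRHS]invrK lef_pV2 ?posrE ?invr_gt0 ?gap_gt0//.
  rewrite /S (bigD1 p)//= addrCA lerDl addr_ge0// sumr_ge0// =>
    q /andP[/gap_gt0/ltW].
  by rewrite invr_ge0.
have r0 : 0 < S^-1 / 2 by rewrite divr_gt0// invr_gt0.
exists (S^-1 / 2) => // x xy i j ij.
have := coord_dist_lt i r0 xy; have := coord_dist_lt j r0 xy.
have := S_gap _ ij; rewrite /gap /= !ltr_norml => ? /andP[? ?] /andP[? ?]; lra.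
Qed.

End Borel.

Section Householder.
Variables (R : realType) (n : nat).
Implicit Types (v x y : 'cV[R]_n) (E W : {vspace 'cV[R]_n}).

(** The reflection in the hyperplane orthogonal to [v]; at [v = 0] it is the identity, so it stays
    orthogonal for every [v]. *)
Definition householder v : 'M[R]_n := 1%:M - (2 / dot v v) *: (v *m v^T).

Lemma householderE v x : householder v *m x = x - (2 * dot v x / dot v v) *: v.
Proof.
rewrite mulmxBl mul1mx -scalemxAl -mulmxA dotE mul_mx_scalar scalerA.
by congr (_ - _ *: _); ring.
Qed.

Lemma householder0 x : householder 0 *m x = x.
Proof. by rewrite householderE scaler0 subr0. Qed.

Lemma householderK v x : householder v *m (householder v *m x) = x.
Proof.
have [->|v0] := eqVneq v 0; first by rewrite !householder0.
have vv0 : dot v v != 0 by rewrite dot_eq0.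
rewrite !householderE dotBr dotZr -addrA -opprD -scalerDl.
rewrite [X in X *: v](_ : _ = 0) ?scale0r ?subr0//.
by field.
Qed.

Lemma householder_tr v : (householder v)^T = householder v.
Proof. by rewrite /householder linearB/= trmx1 linearZ/= trmx_mul trmxK. Qed.

Lemma householder_orthogonal v : (householder v)^T *m householder v = 1%:M.
Proof.
rewrite householder_tr; apply/matrixP => i j.
have /matrixP/(_ i 0) := householderK v (delta_mx j 0).
by rewrite mulmxA -colE !mxE => ->; rewrite eqxx andbT.
Qed.

Lemma householder_dot v x y : dot (householder v *m x) (householder v *m y) =
  dot x y.
Proof. by rewrite dot_mulmx mulmxA householder_orthogonal mul1mx. Qed.

Lemma householder_mem E v x : v \in E -> x \in E -> householder v *m x \in E.
Proof. by move=> vE xE; rewrite householderE rpredB// rpredZ. Qed.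

Lemma householder_swap x y : dot x x = dot y y -> householder (x - y) *m x = y.
Proof.
move=> xy; have [->|neq] := eqVneq x y; first by rewrite subrr householder0.
have d0 : dot (x - y) (x - y) != 0 by rewrite dot_eq0 subr_eq0.
rewrite householderE (_ : 2 * _ / _ = 1) ?scale1r ?subKr//.
apply: canLR (mulfK d0) _; rewrite mul1r.
by rewrite !dotBl !dotBr xy (dotC y x); ring.
Qed.

Lemma orthogonal_vector E W : (\dim W < \dim E)%N ->
  exists u, [/\ u \in E, u != 0 & forall w, w \in W -> dot u w = 0].
Proof.
move=> WE; pose b := vbasis W.
pose M : 'M[R]_(\dim W, n) := \matrix_(k, i) b`_k i 0.
pose g : 'Hom('cV[R]_n, 'cV[R]_(\dim W)) := linfun (mulmx M).
have Mx x k : (M *m x) k 0 = dot b`_k x.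
  by rewrite mxE; apply: eq_bigr => i _; rewrite mxE.
have ker_neq0 : (E :&: lker g)%VS != 0%VS.
  rewrite -dimv_eq0; apply: contraTneq WE => d0.
  rewrite -leqNgt -(limg_ker_dim g E) d0 add0n.
  by apply: leq_trans (dimvS (subvf _)) _; rewrite dimvf /dim/= muln1.
exists (vpick (E :&: lker g)); rewrite vpick0; split=> //.
  by have := memv_pick (E :&: lker g); rewrite memv_cap => /andP[].
move=> w wW; have := memv_pick (E :&: lker g);
  rewrite memv_cap memv_ker lfunE /=.
move=> /andP[_ /eqP/matrixP u0].
rewrite (coord_vbasis wW) dot_sumr big1// => k _.
by rewrite dotZr dotC; have := u0 k 0; rewrite Mx mxE => ->; rewrite mulr0.
Qed.

(** In the plane of [w] and [u] the two reflections compose to a rotation by twice the angle between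
    [w + s *: u] and [w + t *: u]. For distinct nonnegative [s] and [t] that angle is strictly
    between 0 and a right angle, so [w] leaves its own line. *)
Lemma householder_pencil w u (s t : R) : w != 0 -> u != 0 -> dot u w = 0 ->
  0 <= s -> 0 <= t -> s != t ->
  dot u (householder (w + t *: u) *m (householder (w + s *: u) *m w)) != 0.
Proof.
move=> w0 u0 uw s0 t0 st; rewrite dot_mulmx householder_tr !householderE.
have wu : dot w u = 0 by rewrite dotC.
rewrite !(dotNl, dotNr, dotDl, dotDr, dotZl, dotZr) uw wu !(mulr0, addr0,
  add0r).
have := w0; have := u0; rewrite -!dot_gt0.
move: (dot w w) (dot u u) => c e e0 c0.
have den (r : R) : 0 < c + r * (r * e).
  by have := mulr_ge0 (sqr_ge0 r) (ltW e0); rewrite expr2; nra.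
have dt := den t; have ds := den s.
have pst : 0 < c + t * s * e by rewrite ltr_pwDl// !mulr_ge0// ltW.
set N := (X in X != 0).
have -> : N = - (2 * c * e * (s - t) * (c + t * s * e)) /
    ((c + t * (t * e)) * (c + s * (s * e))).
  rewrite /N; field.
  by apply/andP; split; rewrite gt_eqF//; lra.
by rewrite !(mulf_eq0, oppr_eq0, invr_eq0) pnatr_eq0 subr_eq0 (negPf st)
  !gt_eqF.
Qed.

End Householder.

Section UniformOnSphere.
Variables (R : realType) (n : nat) (U : set 'cV[R]_n) (E : {vspace 'cV[R]_n}).
Variable mu : probability (borel_cV R n) R.
Hypotheses (UE : forall x, U x <-> x \in E) (unif : uniform_on_sphere U mu).
Implicit Types (v x y : 'cV[R]_n) (W : {vspace 'cV[R]_n}).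
Local Notation B := (borel_cV R n).

Lemma unit_sphereP x : unit_sphere U x <-> x \in E /\ dot x x = 1.
Proof.
have xx : dot x x = \sum_i x i 0 ^+ 2 by apply: eq_bigr => i _; rewrite expr2.
by rewrite xx; split=> -[/UE].
Qed.

Lemma sphere_complement_negligible : mu.-negligible (~` unit_sphere U).
Proof.
have mS : measurable (unit_sphere U : set B).
  have -> : unit_sphere U = [set x | x \in E] `&` [set x | \sum_i x i 0 ^+ 2 =
    1].
    by apply/seteqP; split=> x /= [/UE].
  apply: measurableI; first exact: vspace_borel.
  apply: closed_borel.
  apply: (@closed_comp _ _ (fun x : 'cV[R]_n => \sum_i x i 0 ^+ 2) [set 1]).
    move=> x _; apply: (@continuous_coord_sum R n (fun _ t => t ^+ 2)) => i t.
    exact: exprn_continuous.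
  exact: closed_eq.
have [mu1 _] := unif.
apply/negligibleP; first exact: measurableC.
by have := probability_setC mu mS; rewrite mu1 subee.
Qed.

Lemma almost_surely_mem : {ae mu, forall x : 'cV[R]_n, x \in E}.
Proof.
apply: negligibleS sphere_complement_negligible => x /= nE [/UE xE _].
exact: nE.
Qed.

Lemma householder_invariant v (A : set B) : v \in E -> measurable A ->
  mu ((fun x : 'cV[R]_n => householder v *m x) @^-1` A) = mu A.
Proof.
move=> vE mA; have [_ inv] := unif.
apply: inv => //; first exact: householder_orthogonal.
by move=> x /UE xE; apply/UE; exact: householder_mem.
Qed.

(** Induction on the dimension supplies the null pairwise intersections of the reflected copies; the
    zero subspace misses the sphere. *)
Lemma subspace_null W : (\dim W < \dim E)%N -> (W <= E)%VS ->
  mu [set x | x \in W] = 0%E.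
Proof.
have [k] := ubnP (\dim W); elim: k W => // k IHk W; rewrite ltnS => Wk WdE WE.
have [->|W0] := eqVneq W 0%VS.
  apply/negligibleP; first exact: vspace_borel.
  apply: negligibleS sphere_complement_negligible => x /=.
  rewrite memv0 => /eqP -> /unit_sphereP[_]; rewrite dot0r => /eqP.
  by rewrite eq_sym oner_eq0.
have [u [uE u0 uW]] := orthogonal_vector WdE.
pose w := vpick W; have wW : w \in W by exact: memv_pick.
have w0 : w != 0 by rewrite vpick0.
have wE : w \in E by exact: (subvP WE).
pose v (t : nat) := w + t%:R *: u.
have vE t : v t \in E by rewrite rpredD// rpredZ.
pose f t : 'End('cV[R]_n) := linfun (mulmx (householder (v t))).
pose Wt t := (f t @: W)%VS.
have WtP t x : (x \in Wt t) = (householder (v t) *m x \in W).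
  apply/memv_imgP/idP => [[y yW ->]|xW].
    by rewrite lfunE /= householderK.
  by exists (householder (v t) *m x); rewrite // lfunE /= householderK.
have dimWt t : \dim (Wt t) = \dim W.
  apply: limg_dim_eq; apply/eqP; rewrite -subv0; apply/subvP => x.
  rewrite memv_cap memv_ker lfunE /= memv0 => /andP[_ /eqP hx0].
  by rewrite -(householderK (v t) x) hx0 mulmx0.
apply: (@equimeasurable_null _ _ _ mu (mu [set x | x \in W]) (fun t =>
  [set x | x \in Wt t])).
- by move=> t; exact: vspace_borel.
- move=> t; have <- : mu ((fun x : 'cV[R]_n => householder (v t) *m x) @^-1`
    [set x | x \in W]) =
      mu [set x | x \in W] by apply: householder_invariant;
        [exact: vE|exact: vspace_borel].
  by congr (mu _); apply/seteqP; split=> x /=; rewrite WtP.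
- move=> t s ts.
  have mI : [set x | x \in Wt t] `&` [set x | x \in Wt s] =
    [set x | x \in (Wt t :&: Wt s)%VS].
    by apply/seteqP; split=> x /=; rewrite memv_cap; move/andP.
  (* Otherwise the copies coincide, and two reflections carry [w] back into [W], which is orthogonal
     to [u], against [householder_pencil]. *)
  have lt_dim : (\dim (Wt t :&: Wt s) < \dim W)%N.
    rewrite ltn_neqAle -{2}(dimWt t) dimvS ?capvSl// andbT.
    apply/negP => /eqP dimI.
    have eqI r : (Wt t :&: Wt s <= Wt r)%VS -> (Wt t :&: Wt s)%VS = Wt r.
      by move=> sub; apply/eqP; rewrite eqEdim sub dimWt dimI leqnn.
    have : householder (v s) *m w \in Wt s by rewrite WtP householderK.
    rewrite -(eqI s (capvSr _ _)) (eqI t (capvSl _ _)) WtP => /uW /eqP.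
    apply/negP; apply: householder_pencil; rewrite ?ler0n// ?uW//.
    by rewrite eqr_nat eq_sym.
  rewrite mI; apply/negligibleP; first exact: vspace_borel.
  apply: IHk; first exact: leq_trans lt_dim Wk.
    exact: ltn_trans lt_dim WdE.
  apply/subvP => x; rewrite memv_cap WtP => /andP[xW _].
  by rewrite -(householderK (v t) x) householder_mem// (subvP WE).
Qed.

(* Householder reflections move a ball around a point of the sphere to a ball
   of the same radius around any other one, and countably many of these balls
   cover the sphere. *)
Lemma ball_gt0 x0 (r : R) (A : set B) : x0 \in E -> dot x0 x0 = 1 -> 0 < r ->
  measurable A -> (forall x, dot (x - x0) (x - x0) < r ^+ 2 -> A x) ->
  (0 < mu A)%E.
Proof.
move=> x0E x01 r0 mA sub; rewrite lt0e measure_ge0 andbT;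
  apply/negP => /eqP muA.
pose D y := [set x | dot (x - y) (x - y) < r ^+ 2].
have mD y : measurable (D y : set B) by apply: open_borel;
  exact: dist_ball_open.
have D0 : mu (D x0) = 0%E.
  apply/negligibleP; first exact: mD.
  have nA : mu.-negligible A by apply/negligibleP.
  by apply: negligibleS nA => x; exact: sub.
have Dnull y : unit_sphere U y -> mu.-negligible (D y).
  move=> /unit_sphereP[yE y1]; apply/negligibleP; first exact: mD.
  have yx : dot y y = dot x0 x0 by rewrite y1 x01.
  have vE : y - x0 \in E by exact: rpredB.
  rewrite -[RHS]D0 -(householder_invariant vE (mD x0)).
  have e x : householder (y - x0) *m x - x0 = householder (y - x0) *m (x - y).
    by rewrite mulmxBr (householder_swap yx).
  by congr (mu _); apply/seteqP; split=> x; rewrite /D /= e householder_dot.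
(* Points of a common grid cell are at squared distance at most [n%:R * delta ^+ 2], which is below
   [r ^+ 2] even for [n = 0]. *)
pose delta := r / n.+1%:R.
have delta0 : 0 < delta by rewrite divr_gt0.
(* Cells have countably many labels, and a cell meeting the sphere lies in the null ball around any
   of its points on the sphere. *)
pose cell x : 'cV[int]_n := \col_i Num.floor (x i 0 / delta).
have cell_close x y : cell x = cell y -> dot (x - y) (x - y) < r ^+ 2.
  move=> /matrixP xy.
  have coord i : (x - y) i 0 * (x - y) i 0 <= delta ^+ 2.
    have := xy i 0; rewrite !mxE => fl.
    have /andP[xl xu] := floor_itv (x i 0 / delta).
    have /andP[yl yu] := floor_itv (y i 0 / delta).
    rewrite -fl in yl yu; rewrite intrD in xu yu.
    rewrite ler_pdivlMr// in xl; rewrite ler_pdivlMr// in yl.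
    rewrite ltr_pdivrMr// in xu; rewrite ltr_pdivrMr// in yu.
    move: xl xu yl yu; move: (_%:~R) => m xl xu yl yu.
    have ub : x i 0 - y i 0 <= delta by lra.
    have lb : - delta <= x i 0 - y i 0 by lra.
    nra.
  have le : dot (x - y) (x - y) <= n%:R * delta ^+ 2.
    rewrite mulr_natl -[X in _ *+ X]card_ord -sumr_const.
    by apply: ler_sum => i _; exact: coord.
  apply: le_lt_trans le _; rewrite expr_div_n mulrCA gtr_pMr ?exprn_gt0//.
  rewrite ltr_pdivrMr ?exprn_gt0// mul1r -natrX ltr_nat.
  by rewrite -mulnn; nia.
have center m : exists y : 'cV[R]_n,
    (exists2 z, unit_sphere U z & cell z = m) -> unit_sphere U y /\ cell y = m.
  have [[z Sz zm]|no] := pselect (exists2 z, unit_sphere U z & cell z = m).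
    by exists z.
  by exists 0 => /no.
have [y yP] := choice center.
pose F k := if unpickle k is Some m then
  [set x | unit_sphere U x /\ cell x = m] else set0.
have Fnull k : mu.-negligible (F k).
  rewrite /F; case: unpickle => [m|]; last exact: negligible_set0.
  have [[z Sz zm]|no] := pselect (exists2 z, unit_sphere U z & cell z = m).
    have [Sy ym] : unit_sphere U (y m) /\ cell (y m) = m by apply: yP; exists z.
    by apply: negligibleS (Dnull _ Sy) => x [Sx xm]; apply: cell_close;
      rewrite xm.
  apply: (negligibleS _ (negligible_set0 mu)) => x [Sx xm].
  by case: no; exists x.
have Snull : mu.-negligible (unit_sphere U).
  apply: negligibleS (negligible_bigcup Fnull) => x Sx.
  by exists (pickle (cell x)) => //; rewrite /F pickleK.
have : mu.-negligible ([set: B]).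
  apply: negligibleS (negligibleU Snull sphere_complement_negligible) => x _.
  by rewrite setUv.
move/(negligibleP mu (@measurableT _ B)) => muT.
by have := probability_setT mu; rewrite [LHS]muT => /eqP;
  rewrite eq_sym onee_eq0.
Qed.

End UniformOnSphere.

(** * Uniform random top eigenvectors *)

Section UniformTopEigenvector.
Variables (R : realType) (n : nat) (G : sgraph 'I_n) (lam : R).
Hypotheses (conG : graph_connected G) (compG : comparability_graph G)
  (lamP : largest_eigenvalue (laplacian R G) lam).
Variable mu : probability (borel_cV R n) R.
Local Notation E := (col_eigenspace (laplacian R G) lam).
Local Notation GP := (copartition G (canonical_partition G)).
Hypothesis unif : uniform_on_sphere E mu.

Let UE x : E x <-> x \in lin_span E := iff_sym (mem_span_eigenspace G lam x).

Lemma almost_surely_generic : {ae mu, forall x : 'cV[R]_n, generic G lam x}.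
Proof.
pose N (p : 'I_n * 'I_n) : set 'cV[R]_n := if GP p.1 p.2 then [set x |
  E x /\ x p.1 0 = x p.2 0] else set0.
have Nnull p : mu.-negligible (N p).
  rewrite /N; case: ifPn => [pGP|_]; last exact: negligible_set0.
  pose d : 'Hom('cV[R]_n, 'cV[R]_1) := linfun (mulmx (delta_mx 0 p.1 - delta_mx
    0 p.2)).
  have dE x : (x \in lker d) = (x p.1 0 == x p.2 0).
    rewrite memv_ker lfunE /= mulmxBl -!rowE subr_eq0.
    apply/eqP/eqP => [/matrixP/(_ 0 0)|E0]; first by rewrite !mxE.
    by apply/matrixP => i j; rewrite !mxE !ord1.
  have -> : [set x | E x /\ x p.1 0 = x p.2 0] =
    [set x | x \in (lin_span E :&: lker d)%VS].
    apply/seteqP; split=> x /=; rewrite memv_cap dE.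
      by move=> [/UE-> ->]; rewrite eqxx.
    by move=> /andP[/UE Ex /eqP].
  apply/negligibleP; first exact: vspace_borel.
  apply: (subspace_null UE unif); last exact: capvSl.
  rewrite ltnNge; apply/negP => le_dim.
  have eqE : (lin_span E :&: lker d)%VS = lin_span E.
    by apply/eqP; rewrite eqEdim capvSl.
  have [x [/UE Ex /negP[]]] := copartition_edge_separated conG compG lamP pGP.
  by move: Ex; rewrite -eqE memv_cap dE => /andP[].
have aeN : {ae mu, forall x : 'cV[R]_n, forall p, ~ N p x}.
  apply: filter_forall => p; apply: negligibleS (Nnull p) => x /= nN.
  exact: contrapT.
have aeE : {ae mu, forall x : 'cV[R]_n, x \in lin_span E} := almost_surely_mem UE unif.
have F : Filter (almost_everywhere mu) by exact: ae_filter_ringOfSetsType.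
apply: (@filterS2 _ _ F _ _ _ _ aeE aeN) => x /UE Ex xN; split=> // i j ij.
by apply/eqP => xij; apply: (xN (i, j)); rewrite /N (ij : GP (i, j).1 (i, j).2).
Qed.

(** The event consists of strict inequalities, so it contains a ball around the normalization of an
    eigenvector realizing [O]. *)
Lemma orientation_gt0 O : transitive_orientation GP O ->
  (0 < mu [set x : 'cV[R]_n | induced_orientation GP x = O])%E.
Proof.
move=> tO.
have -> : [set x : 'cV[R]_n | induced_orientation GP x = O] =
  strictly_ordered O.
  by apply/seteqP; split=> x /=; move/(induced_orientationE x tO).
have [x [Ex x0 xO]] : exists x, [/\ E x, x != 0 & strictly_ordered O x].
  have [x [Ex xO]] := copartition_orientation_realized conG compG lamP tO.
  (* If [x] is zero then [O] has no arcs, and any nonzero top eigenvector will do. *)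
  have [x0|] := eqVneq x 0; last by exists x.
  have [y Ey y0] := eigenvector_ex (laplacian_sym R G) lamP.
  by exists y; split=> // i j /xO; rewrite x0 !mxE ltxx.
pose s := Num.sqrt (dot x x).
have s0 : 0 < s by rewrite sqrtr_gt0 dot_gt0.
pose x1 := s^-1 *: x.
have x1O : strictly_ordered O x1.
  by move=> i j ij; rewrite !mxE ltr_pM2l ?invr_gt0//; exact: xO.
have [r r0 sub] := strictly_ordered_ball x1O.
apply: (ball_gt0 UE unif _ _ r0 (strictly_ordered_borel _) sub).
- by rewrite rpredZ//; apply/UE.
- rewrite dotZl dotZr mulrA -[dot x x]sqr_sqrtr ?dot_ge0// -/s.
  by field; rewrite gt_eqF.
Qed.

End UniformTopEigenvector.

Theorem theorem3p1 (R : realType) (n : nat) (G : sgraph 'I_n) (lam : R)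
    (hconn : graph_connected G) (hcomp : comparability_graph G)
    (hlam : largest_eigenvalue (laplacian R G) lam) :
  let P := canonical_partition G in
  let GP := copartition G P in
  let E := col_eigenspace (laplacian R G) lam in
  (* i *)
  (forall O, transitive_orientation G O ->
     dim_linspan (cone O `&` E) = dim_linspan E) /\
  (* ii *)
  E `<=` \bigcup_(O in [set` transitive_orientations G]) cone O /\
  (* iii *)
  (forall mu : probability (borel_cV R n) R, uniform_on_sphere E mu ->
     (* 1 *)
     {ae mu, forall x : 'cV[R]_n, forall A, A \in P ->
        exists xi, fiber x xi /\ A \subset xi} /\
     (* 2 *)
     {ae mu, forall x : 'cV[R]_n, forall A A', A \in P -> A' \in P ->
        completely_adjacent G A A' ->
        exists xi xi', [/\ fiber x xi, fiber x xi', xi <> xi',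
                          A \subset xi & A' \subset xi']} /\
     (* 3 *)
     {ae mu, forall x : 'cV[R]_n,
        transitive_orientation GP (induced_orientation GP x)} /\
     (* 4 *)
     (forall O, transitive_orientation GP O ->
        (0 < mu [set x : 'cV[R]_n | induced_orientation GP x = O])%E) /\
     (* 5 *)
     {ae mu, forall x : 'cV[R]_n, forall xi, fiber x xi ->
        exists Q : {set {set 'I_n}}, induced_disjoint_union G xi Q /\
          forall B, B \in Q ->
            [/\ is_module G B, graph_connected (induced_subgraph G B)
              & comparability_graph (induced_subgraph G B)]} /\
     (* 6; a one-vertex graph has exactly one transitive orientation *)
     ((1 < n)%N ->
      {ae mu, forall x : 'cV[R]_n,
         #|transitive_orientations G| = 2%N <->
         dim_linspan E = 1%N /\ (forall xi, fiber x xi -> independent G xi)})) /\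
  comparability_graph GP /\
  (* iv *)
  (graph_connected (complement_graph G) -> dim_linspan E = 1%N) /\
  (~~ graph_connected (complement_graph G) ->
     dim_linspan E = (#|graph_components (complement_graph G)| - 1)%N).
Proof.
move=> P GP E.
have cover x : E x -> exists O, transitive_orientation G O /\ cone O x.
  exact: eigenspace_cone_cover.
split=> [ O tO|]; first exact: dim_cone_eigenspace.
split=> [x /cover[ O [tO cx]]|].
  by exists O => //=; rewrite inE.
split=> [mu unif|].
  have aeG := almost_surely_generic hconn hcomp hlam unif.
  have F : Filter (almost_everywhere mu) by exact: ae_filter_ringOfSetsType.
  do 5?split.
  - apply: (@filterS _ _ F _ _ _ aeG) => x [Ex _] A AP.
    have [xi [fxi sA _]] := eigenspace_block_fiber hconn hlam Ex AP.
    by exists xi.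
  - apply: (@filterS _ _ F _ _ _ aeG) => x gx A A' AP A'P.
    exact: generic_adjacent_blocks gx AP A'P.
  - by apply: (@filterS _ _ F _ _ _ aeG) => x;
      exact: generic_transitive_orientation.
  - by move=> O tO; exact: orientation_gt0 unif O tO.
  - apply: (@filterS _ _ F _ _ _ aeG) => x [Ex _] xi fxi;
      have [ O [tO cx]] := cover x Ex.
    exact: (fiber_modules tO hcomp cx Ex fxi).
  - by move=> n1; apply: (@filterS _ _ F _ _ _ aeG) => x;
      exact: two_orientations_generic.
split; first exact: copartition_comparability hcomp hlam.
split=> [conc|disc].
  have [ O tO] := comparability_graph_orientable hcomp.
  exact: dim_eigenspace_coconnected tO.
by rewrite (dim_eigenspace_blocks hconn disc hlam) /canonical_partition (negPf
  disc).
Qed.
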